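(* Let $\Delta_m$ be a polygon with $m\ge 4$ sides and let $\mathbb{F}_q$ be the finite field with $q$ elements. Then the number of $\mathbb{F}_q$-points of the corresponding cluster variety (with boundary coefficients) is $$\#\mathcal{A}(\Delta_m;\mathbb{F}_q)=(q-1)^{m-1}\left(\frac{q^{m-1}+(-1)^m}{q+1}\right).$$
   Context: $\Delta_m$ denotes a polygon with $m$ sides, i.e. an oriented disk with $m$ marked points (vertices) on its boundary; the sides are the boundary arcs. A triangulation $T$ of $\Delta_m$ is a maximal collection of pairwise non-crossing diagonals, together with the sides. Cluster algebra: the ice quiver $Q_T$ of $T$ has one frozen vertex for each of the $m$ sides and one mutable vertex for each of the $m-3$ diagonals of $T$; in each triangle draw arrows between its sides in clockwise order, omitting arrows between frozen vertices. The initial seed consists of $Q_T$ together with algebraically independent variables $x_v$ indexed by its vertices. Mutation at a mutable vertex $k$ applies the usual quiver mutation and replaces $x_k$ by $x_k'$, where $x_kx_k'=\prod_{k\to j}x_j+\prod_{i\to k}x_i$ (products over arrows). Clusters are the sets of variables (frozen ones included) in seeds obtained by iterated mutation; they correspond to triangulations, and cluster variables to diagonals and sides. The cluster algebra $A(\Delta_m)$ is the $\mathbb{Z}$-subalgebra of $\mathbb{Q}(x_v)$ generated by all cluster variables and the inverses of the frozen variables (those of the sides); up to isomorphism it does not depend on $T$. The cluster variety over a field $\Bbbk$ is $\mathcal{A}(\Delta_m;\Bbbk)=\operatorname{Spec}(A(\Delta_m)\otimes_{\mathbb{Z}}\Bbbk)$, and $\#\mathcal{A}(\Delta_m;\mathbb{F}_q)$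 denotes its number of $\mathbb{F}_q$-points, i.e. the number of ring homomorphisms $A(\Delta_m)\to\mathbb{F}_q$. *)

(* Defs.v *)
From HB Require Import structures.
From mathcomp Require Import all_boot all_order all_algebra.
From mathcomp Require Import boolp.
From mathcomp Require Import mpoly.

Set Implicit Arguments.
Unset Strict Implicit.
Unset Printing Implicit Defensive.

Import Order.TTheory GRing.Theory Num.Theory.

Local Open Scope ring_scope.

(* Quivers: [arrows i j] is the number of arrows from i to j. *)

Record ice_quiver (V : finType) := IceQuiver {
  frozen : pred V;
  arrows : V -> V -> nat
}.

(* Away from k, truncated subtraction performs the cancellation of oriented
   2-cycles after an arrow i -> j has been added for each path i -> k -> j. *)
Definition mutate_arrows (V : finType) (Q : ice_quiver V) (k i j : V) : nat :=
  if (i == k) || (j == k) then arrows Q j i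
  else if frozen Q i && frozen Q j then 0%N
  else ((arrows Q i j + arrows Q i k * arrows Q k j)
        - (arrows Q j i + arrows Q j k * arrows Q k i))%N.

Definition mutate_quiver (V : finType) (Q : ice_quiver V) (k : V) :
    ice_quiver V :=
  IceQuiver (frozen Q) (mutate_arrows Q k).

Record seed (V : finType) (K : fieldType) := Seed {
  seed_quiver : ice_quiver V;
  seed_var : V -> K
}.

Definition mutate_seed (V : finType) (K : fieldType) (s : seed V K) (k : V) :
    seed V K :=
  Seed (mutate_quiver (seed_quiver s) k)
    (fun v => if v == k then
        (\prod_j seed_var s j ^+ arrows (seed_quiver s) k j
         + \prod_i seed_var s i ^+ arrows (seed_quiver s) i k) / seed_var s k
      else seed_var s v).

Inductive mutation_equivalent (V : finType) (K : fieldType) (s : seed V K) :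
    seed V K -> Prop :=
  | mutation_equivalent_refl : mutation_equivalent s s
  | mutation_equivalent_step (s' : seed V K) (k : V) :
      mutation_equivalent s s' -> ~~ frozen (seed_quiver s') k ->
      mutation_equivalent s (mutate_seed s' k).

Definition ambient_field (V : finType) : fieldType :=
  {fraction {mpoly rat[#|V|]}}.

Definition initial_var (V : finType) (v : V) : ambient_field V :=
  tofrac 'X_(enum_rank v).

Definition initial_seed (V : finType) (Q : ice_quiver V) :
    seed V (ambient_field V) :=
  Seed Q (@initial_var V).

(* Frozen variables are cluster variables too. *)
Definition is_cluster_variable (V : finType) (Q : ice_quiver V)
    (x : ambient_field V) : Prop :=
  exists (s : seed V (ambient_field V)) (v : V),
    mutation_equivalent (initial_seed Q) s /\ x = seed_var s v.

Definition cluster_generator (V : finType) (Q : ice_quiver V)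
    (x : ambient_field V) : Prop :=
  is_cluster_variable Q x
  \/ (exists v : V, frozen Q v /\ x = (initial_var v)^-1).

Definition generated_subring (R : nzRingType) (S : R -> Prop) : {pred R} :=
  fun x => `[< forall P : {pred R}, subring_closed P ->
               (forall y, S y -> y \in P) -> x \in P >].

Lemma generated_subring_closed (R : nzRingType) (S : R -> Prop) :
  subring_closed (generated_subring S).
Proof.
split.
- by apply/asboolP => P [].
- move=> x y /asboolP hx /asboolP hy; apply/asboolP => P hP hS.
  by have [_ hB _] := hP; apply: hB; [exact: hx | exact: hy].
- move=> x y /asboolP hx /asboolP hy; apply/asboolP => P hP hS.
  by have [_ _ hM] := hP; apply: hM; [exact: hx | exact: hy].
Qed.

HB.instance Definition _ (R : nzRingType) (S : R -> Prop) :=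
  GRing.isSubringClosed.Build R (generated_subring S)
    (generated_subring_closed S).

Record cluster_algebra (V : finType) (Q : ice_quiver V) := ClusterAlgebra {
  cluster_algebra_val : ambient_field V;
  _ : cluster_algebra_val \in generated_subring (cluster_generator Q)
}.

HB.instance Definition _ (V : finType) (Q : ice_quiver V) :=
  [isSub for @cluster_algebra_val V Q].
HB.instance Definition _ (V : finType) (Q : ice_quiver V) :=
  [Choice of cluster_algebra Q by <:].
HB.instance Definition _ (V : finType) (Q : ice_quiver V) :=
  [SubChoice_isSubComNzRing of cluster_algebra Q by <:].

(* The vertices of the m-gon are 0, ..., m-1 in clockwise order; a side or
   diagonal is represented by its pair of end points. *)

Definition sides (m : nat) : {set {set 'I_m}} :=
  [set [set i; ordS i] | i : 'I_m].

Definition diagonals (m : nat) : {set {set 'I_m}} :=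
  [set a : {set 'I_m} | #|a| == 2%N] :\: sides m.

Definition crossing (m : nat) (a b : {set 'I_m}) : bool :=
  [exists i : 'I_m, exists k : 'I_m, exists j : 'I_m, exists l : 'I_m,
    [&& (i < k < j)%N, (j < l)%N &
        ((a == [set i; j]) && (b == [set k; l]))
        || ((a == [set k; l]) && (b == [set i; j]))]].

Definition noncrossing_collection (m : nat) (D : {set {set 'I_m}}) : bool :=
  (D \subset diagonals m)
  && [forall a in D, forall b in D, ~~ crossing a b].

Definition is_triangulation (m : nat) (T : {set {set 'I_m}}) : Prop :=
  exists2 D : {set {set 'I_m}},
    maxset (@noncrossing_collection m) D & T = sides m :|: D.

Definition clockwise (m : nat) (i j k : 'I_m) : bool :=
  [|| (i < j < k)%N, (j < k < i)%N | (k < i < j)%N].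

Definition arc (m : nat) (T : {set {set 'I_m}}) : finType :=
  {a : {set 'I_m} | a \in T}.

(* Walking clockwise around a triangle with vertices i, j, k in clockwise
   order, the side ij is followed by the side jk. Since the arcs of T do not
   cross and all marked points lie on the boundary, any three pairwise distinct
   points joined by arcs of T bound a triangle of T. *)
Definition triangulation_arrows (m : nat) (T : {set {set 'I_m}})
    (a b : arc T) : nat :=
  if (val a \in sides m) && (val b \in sides m) then 0%N
  else #|[set t : 'I_m * 'I_m * 'I_m |
      [&& clockwise t.1.1 t.1.2 t.2,
          val a == [set t.1.1; t.1.2], val b == [set t.1.2; t.2] &
          [set t.2; t.1.1] \in T]]|.

Definition triangulation_quiver (m : nat) (T : {set {set 'I_m}}) :
    ice_quiver (arc T) :=
  IceQuiver [pred a : arc T | val a \in sides m] (@triangulation_arrows m T).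

Definition cluster_variety_point (m : nat) (T : {set {set 'I_m}})
    (F : fieldType) : Type :=
  {rmorphism cluster_algebra (triangulation_quiver T) -> F}.

(* Main.v *)
Require Import Defs.
From HB Require Import structures.
From mathcomp Require Import all_boot all_order all_algebra.
From mathcomp Require Import boolp mpoly zify ring.

Set Implicit Arguments.
Unset Strict Implicit.
Unset Printing Implicit Defensive.

Import GRing.Theory.
Local Open Scope ring_scope.

(** A point of the cluster variety is a configuration of vectors v_0, ...,
    v_(m-1) of the plane F^2, up to SL_2, in which cyclically consecutive
    vectors are independent; the value of the cluster variable of the arc i j
    is det (v_i, v_j). Counting such configurations is a two-state recursion.

    Seeds are triangulations: a mutable vertex of the quiver of a triangulation
    is a diagonal a c, its two triangles form a quadrilateral a b c d, and
    mutation replaces a c by b d ([tri_flip]), the exchange relation being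
    ac * bd = ab * cd + bc * da. Every triangulation can be flipped to the star
    of any given vertex ([reach_star]), so every arc occurs in some seed.

    The same relation holds between the determinants of any four vectors. A
    star is easily realized by vectors over the ambient field, and going back
    along the flips these vectors realize the initial seed, hence all seeds
    ([coordinates_exist]): the cluster variables are the 2 x 2 minors P i j of
    one matrix. They satisfy all Pluecker relations, so a point phi is
    recovered from the vectors (- phi (P 1 k) / phi (P 0 1), phi (P 0 k)),
    which form the representative of the SL_2 orbit with v_0 = (1, 0) and
    v_1 = (0, b).

    Conversely each configuration over F must be shown to come from a
    morphism. If all the determinants are nonzero, one may send the initial
    variables to them; but in a configuration with few distinct directions
    every triangulation may contain a diagonal of value zero, and then no
    choice of initial variables helps. The remedy is to deform the vectors to
    vectors over F[t] that are pairwise independent ([generic_deformation]):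
    the initial variables can be sent to the nonzero determinants in F(t), the
    images of the generators of the cluster algebra are then regular at t = 0,
    and evaluating there gives the required point ([point_of_configuration]).
    Both steps are specializations of a fraction field along a ring morphism
    that does not kill the denominators in use ([specializes]).

    For the count, walk along v_1, v_2, ... and only remember whether the second
    coordinate, that is det (v_0, v_k), vanishes ([card_open_paths]). *)

(** * Cyclic order and triangulations of a polygon *)

Ltac cyclic := clear; rewrite /clockwise; lia.

Section PolygonGeometry.

Variable n : nat.
Local Notation m := n.+3.
Implicit Types (i j k l a b c d x y : 'I_m) (A B : {set 'I_m}) (T : {set {set 'I_m}}).

Lemma set2_inj (I : finType) (i j k l : I) :
  [set i; j] = [set k; l] -> i = k /\ j = l \/ i = l /\ j = k.
Proof.
move=> e.
have hi : i \in [set k; l] by rewrite -e set21.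
have hj : j \in [set k; l] by rewrite -e set22.
have hk : k \in [set i; j] by rewrite e set21.
have hl : l \in [set i; j] by rewrite e set22.
case/set2P: hi => ?; case/set2P: hj => ?; case/set2P: hk => ?;
  case/set2P: hl => ?; subst; by [left | right].
Qed.

Lemma ordS_val i : ordS i = (if i == n.+2 :> nat then 0%N else i.+1) :> nat.
Proof.
rewrite /=; have := ltn_ord i; case: eqP => [->|h hi]; first by rewrite modnn.
by rewrite modn_small //; lia.
Qed.

Lemma clockwise_neq i j k : clockwise i j k -> [/\ i != j, j != k & k != i].
Proof. by rewrite /clockwise -!val_eqE /=; split; lia. Qed.

Lemma clockwise_total i j k :
  i != j -> j != k -> k != i -> ~~ clockwise i j k -> clockwise i k j.
Proof. rewrite /clockwise -!val_eqE /=; lia. Qed.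

Lemma clockwise_ordS i j : j != i -> j != ordS i -> clockwise i (ordS i) j.
Proof.
rewrite -!val_eqE [val (ordS i)]ordS_val /clockwise ordS_val /=.
by have := ltn_ord i; have := ltn_ord j; case: ifP; lia.
Qed.

(** No arc crosses a side, because nothing lies between a vertex and the next. *)
Lemma ordS_not_separated i j k :
  clockwise i k j -> clockwise j (ordS k) i -> False.
Proof.
rewrite /clockwise ordS_val.
by have := ltn_ord i; have := ltn_ord j; case: ifP; lia.
Qed.

Lemma ordS_neq i : i != ordS i.
Proof. by rewrite -val_eqE [val (ordS i)]ordS_val /=; case: ifP; lia. Qed.

(** The form of a triangulation that flips transform easily: maximality is
    replaced by the existence, next to each arc i j, of a triangle on the
    side of the vertices met when walking clockwise from i to j. *)
Definition triangulated T : Prop :=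
  [/\ forall A, A \in T -> #|A| = 2%N,
      sides m \subset T,
      forall i j k l, [set i; j] \in T -> [set k; l] \in T ->
        clockwise i k j -> clockwise j l i -> False
    & forall i j k, [set i; j] \in T -> clockwise i k j ->
        exists h, [/\ clockwise i h j, [set i; h] \in T & [set h; j] \in T]].

Lemma crossing_set2 i j B :
  crossing [set i; j] B ->
  exists k l, [/\ B = [set k; l], clockwise i k j & clockwise j l i].
Proof.
case/existsP=> p /existsP[q /existsP[r /existsP[s /and3P[h1 h2]]]].
case/orP=> /andP[/eqP /set2_inj e /eqP ->];
  case: e => -[-> ->];
  by [exists q, s; rewrite /clockwise; split=> //; lia
     | exists s, q; rewrite [RHS]setUC /clockwise; split=> //; lia
     | exists p, r; rewrite /clockwise; split=> //; lia
     | exists r, p; rewrite [RHS]setUC /clockwise; split=> //; lia].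
Qed.

Lemma clockwise_crossing i j k l :
  clockwise i k j -> clockwise j l i -> crossing [set i; j] [set k; l].
Proof.
move=> h1 h2.
have mk (p q r s : 'I_m) : (p < q < r)%N -> (r < s)%N ->
    ([set i; j] = [set p; r] /\ [set k; l] = [set q; s]) \/
    ([set i; j] = [set q; s] /\ [set k; l] = [set p; r]) ->
    crossing [set i; j] [set k; l].
  move=> u v w; apply/existsP; exists p; apply/existsP; exists q.
  apply/existsP; exists r; apply/existsP; exists s; rewrite u v /=.
  by case: w => -[-> ->]; rewrite !eqxx ?orbT.
have [u|[u|[u|u]]] : [&& i < k, k < j & j < l]%N \/ [&& k < j, j < l & l < i]%N
   \/ [&& j < l, l < i & i < k]%N \/ [&& l < i, i < k & k < j]%N.
- by move: h1 h2; cyclic.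
- by apply: (mk i k j l); [lia | lia | left].
- apply: (mk k j l i); [lia | lia |].
  by right; split=> //; rewrite setUC.
- by apply: (mk j l i k); [lia | lia | left; rewrite setUC; split=> //; rewrite setUC].
- by apply: (mk l i k j); [lia | lia | right; split=> //; rewrite setUC].
Qed.

Lemma crossing_sym A B : crossing A B = crossing B A.
Proof.
rewrite /crossing; do 4!apply: eq_existsb => ?.
by rewrite orbC andbC [X in _ || X]andbC [in X in X || _]andbC andbC.
Qed.

Lemma sides_not_separated A k l i j :
  A \in sides m -> A = [set k; l] -> clockwise i k j -> clockwise j l i -> False.
Proof.
case/imsetP=> x _ -> /esym/set2_inj[] [-> ->]; first exact: ordS_not_separated.
by move=> h1 h2; apply: (ordS_not_separated h2 h1).
Qed.

(** For the candidates between i and j, the distance walked clockwise from i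
    decides which one is last. *)
Lemma last_before i j h0 (P : pred 'I_m) : clockwise i h0 j && P h0 ->
  exists h, [/\ clockwise i h j, P h & forall x, clockwise h x j -> ~~ P x].
Proof.
pose dist (h : 'I_m) := ((h + m - i) %% m)%N.
have distE h : dist h = (if (i <= h)%N then h - i else h + m - i)%N.
  rewrite /dist; have := ltn_ord h; have := ltn_ord i => u1 u2.
  case: ifP => u3; last by rewrite modn_small //; lia.
  by rewrite -addnBAC // modnDr modn_small //; lia.
pose Q h := clockwise i h j && P h.
move=> c0; have {}c0 : Q h0 by [].
case: (arg_maxnP dist c0) => h /andP[ch hh] hmax.
exists h; split=> // x cx; apply/negP=> Px.
have cix : clockwise i x j by move: cx ch; cyclic.
have := hmax x; rewrite /Q cix Px => /(_ isT); rewrite !distE.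
move: cx ch; have := ltn_ord x; have := ltn_ord h; have := ltn_ord i.
by clear; rewrite /clockwise /=; do 2!case: ifP; lia.
Qed.

(** The triangle next to the arc i j: its apex is the last neighbour h of i
    before j, and h j is crossed by no arc, so it belongs to T by maximality. *)
Lemma maximal_triangulated T : is_triangulation T -> triangulated T.
Proof.
case=> D /maxsetP[/andP[sD /forall_inP ncD] maxD] ->.
have card_side A : A \in sides m -> #|A| = 2%N.
  by case/imsetP=> x _ ->; rewrite cards2 ordS_neq.
have card_diag A : A \in diagonals m -> #|A| = 2%N by rewrite !inE => /andP[_ /eqP].
have nc i j k l : [set i; j] \in sides m :|: D -> [set k; l] \in sides m :|: D ->
    clockwise i k j -> clockwise j l i -> False.
  rewrite !in_setU => /orP[hs|hD] /orP[hs'|hD'] h1 h2.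
  - exact: (sides_not_separated hs' erefl h1 h2).
  - by apply: (sides_not_separated (i := l) (j := k) hs erefl); move: h1 h2; cyclic.
  - exact: (sides_not_separated hs' erefl h1 h2).
  - by move/forall_inP: (ncD _ hD) => /(_ _ hD'); rewrite clockwise_crossing.
have sat i j : i != j ->
    (forall k l, [set k; l] \in sides m :|: D -> clockwise i k j -> clockwise j l i -> False) ->
    [set i; j] \in sides m :|: D.
  move=> nij hcross; rewrite in_setU; case: (boolP (_ \in sides m)) => //= hs.
  suff -> : D = [set i; j] |: D by rewrite setU11.
  apply/esym/maxD; last exact: subsetUr.
  have nocross B : B \in [set i; j] |: D -> ~~ crossing [set i; j] B.
    move=> hB; apply/negP=> /crossing_set2[k [l [eB h1 h2]]].
    move: hB; rewrite eB in_setU1 => /orP[/eqP /set2_inj e|hB]; last first.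
      by apply: (hcross k l) => //; rewrite in_setU hB orbT.
    have [u1 u2 _] := clockwise_neq h1; have [_ _ _] := clockwise_neq h2.
    by case: e => -[e _]; move: u1 u2; rewrite e eqxx.
  apply/andP; split.
    apply/subsetP=> B; rewrite in_setU1 => /orP[/eqP->|/(subsetP sD)//].
    by rewrite !inE hs cards2 nij.
  apply/forall_inP=> A hA; apply/forall_inP=> B hB.
  move: (hA); rewrite in_setU1 => /orP[/eqP->|hA']; first exact: nocross.
  move: (hB); rewrite in_setU1 => /orP[/eqP->|hB'].
    by rewrite crossing_sym; apply: nocross.
  by move/forall_inP: (ncD _ hA') => /(_ _ hB').
split=> //.
- by move=> A; rewrite in_setU => /orP[/card_side//|/(subsetP sD)/card_diag].
- exact: subsetUl.
move=> i j k hij hk.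
have c0 : clockwise i (ordS i) j && ([set i; ordS i] \in sides m :|: D).
  have [u1 u2 u3] := clockwise_neq hk.
  rewrite in_setU [[set _; _] \in sides m]imset_f // andbT.
  apply: clockwise_ordS => //; apply/eqP=> e; subst j.
  have := ltn_ord k; move: hk; rewrite /clockwise ordS_val; case: ifP; lia.
have [h [ch hh hmax]] := last_before (P := fun h => [set i; h] \in sides m :|: D) c0.
exists h; split=> //; have [v1 v2 v3] := clockwise_neq ch.
apply: sat => // x y hxy h1 h2.
(* An arc x y that separates h from j stays clear of i j and i h, so it ends
   at i, and then x is a later neighbour of i than h. *)
have [w1 w2 w3] := clockwise_neq h2.
have cx : clockwise i x j by move: h1 ch; cyclic.
have [ey|/eqP niy] := eqVneq y i.
  by have := hmax _ h1; rewrite setUC -ey hxy.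
have niy' : y <> i :> nat by move=> /val_inj.
case: (boolP (clockwise j y i)) => c1.
  exact: (nc _ _ _ _ hij hxy cx c1).
apply: (nc i h y x hh); first by rewrite setUC.
  by move: niy' h1 h2 ch c1; cyclic.
by move: niy' h1 h2 ch c1; cyclic.
Qed.

(** Two triangles on the same side of an arc i j would have crossing sides. *)
Lemma apex_uniq T (hT : triangulated T) i j h k : clockwise i h j -> clockwise i k j ->
  [set i; h] \in T -> [set h; j] \in T -> [set i; k] \in T -> [set k; j] \in T ->
  h = k.
Proof.
case: hT => _ _ nc _ ch ck ih hj ik kj; apply/eqP/negP=> /negP.
rewrite -val_eqE /= => nhk.
case: (boolP (clockwise i h k)) => c.
  by apply: (nc i k h j) => //; move: c ch ck; cyclic.
by apply: (nc i h k j) => //; move: nhk c ch ck; cyclic.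
Qed.

(** The diagonal a c and the two triangles a b c, c d a on its sides. *)
Definition quad T a b c d : Prop :=
  [/\ clockwise a b c, clockwise c d a, [set a; c] \in T &
   [/\ [set a; b] \in T, [set b; c] \in T, [set c; d] \in T & [set d; a] \in T]].

Definition flip T a b c d : {set {set 'I_m}} :=
  [set b; d] |: (T :\ [set a; c]).

Lemma quad_exists T A : triangulated T -> A \in T -> A \notin sides m ->
  exists a b c d, A = [set a; c] /\ quad T a b c d.
Proof.
move=> [c2 sT nc fill] AT As.
have /cards2P[a [c [nac eA]]] := introT eqP (c2 _ AT); subst A.
have cas : c != ordS a.
  by apply: contraNneq As => ->; apply: imset_f.
have acs : a != ordS c.
  by apply: contraNneq As => ->; rewrite setUC; apply: imset_f.
have nca : c != a by rewrite eq_sym.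
have CT : [set c; a] \in T by rewrite setUC.
have [b [hb ab bc]] := fill a c _ AT (clockwise_ordS nca cas).
have [d [hd cd da]] := fill c a _ CT (clockwise_ordS nac acs).
by exists a, b, c, d.
Qed.

Lemma quad_neq T a b c d : quad T a b c d ->
  [/\ a != b, a != c, a != d & [/\ b != c, b != d & c != d]].
Proof.
by case=> h1 h2 _ _; move: h1 h2; rewrite /clockwise -!val_eqE /=; split; [| | | split]; lia.
Qed.

Lemma quad_turn T a b c d : quad T a b c d ->
  clockwise b c d /\ clockwise d a b.
Proof. by case=> h1 h2 _ _; move: h1 h2; cyclic. Qed.

(** The quadrilateral survives the flip, read from b instead of a. Statements
    about T and a c thus apply to the flipped triangulation and b d. *)
Lemma quad_flip T a b c d : quad T a b c d -> quad (flip T a b c d) b c d a.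
Proof.
move=> q; have [n1 n2 n3 [n4 n5 n6]] := quad_neq q.
have [cb db] := quad_turn q; case: q => h1 h2 ac [ab bc cd da].
have side x y : [set x; y] \in T -> (x \in [set b; d]) || (y \in [set b; d]) ->
    [set x; y] \in flip T a b c d.
  move=> xy; rewrite !inE xy andbT => hxy; apply/orP; right.
  apply/eqP=> e; have : (b \in [set x; y]) || (d \in [set x; y]).
    by rewrite !inE ![_ == x]eq_sym ![_ == y]eq_sym; case/orP: hxy => /orP[] ->; rewrite ?orbT.
  rewrite e !inE ![_ == a]eq_sym ![_ == c]eq_sym (eq_sym c b).
  by rewrite (negPf n1) (negPf n4) (negPf n3) (negPf n6).
split=> //; first by rewrite setU11.
by split; apply: side => //; rewrite !inE eqxx ?orbT.
Qed.

Lemma flip_triangulated T a b c d :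
  triangulated T -> quad T a b c d -> triangulated (flip T a b c d).
Proof.
move=> hT q; have [n1 n2 n3 [n4 n5 n6]] := quad_neq q.
have [cb db] := quad_turn q; have [_ _ bd' [bc' cd' da' ab']] := quad_flip q.
case: (hT) => c2 sT nc fill.
case: (q) => h1 h2 ac [ab bc cd da].
(* An arc that separates b from d without crossing the quadrilateral is a c. *)
have ncbd k l : [set k; l] \in T -> [set k; l] != [set a; c] ->
    clockwise b k d -> clockwise d l b -> False.
  move=> kl nkl ck cl.
  have kc : k = c.
    apply/eqP/negP=> /negP; rewrite -val_eqE /= => nk.
    case: (boolP (clockwise b k c)) => c1.
      by apply: (nc _ _ _ _ bc kl c1); move: c1 ck cl cb; cyclic.
    by apply: (nc _ _ _ _ cd kl); move: nk c1 ck cl cb; cyclic.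
  have la : l = a.
    apply/eqP/negP=> /negP; rewrite -val_eqE /= => nk.
    rewrite setUC in kl.
    case: (boolP (clockwise d l a)) => c1.
      by apply: (nc _ _ _ _ da kl c1); move: c1 ck cl db; cyclic.
    by apply: (nc _ _ _ _ ab kl); move: nk c1 ck cl db; cyclic.
  by move: nkl; rewrite kc la setUC eqxx.
have nside A : A \in sides m -> A != [set a; c].
  move=> As; apply/eqP=> e; rewrite setUC in e.
  exact: (sides_not_separated As e cb db).
split.
- by move=> A; rewrite !inE => /orP[/eqP->|/andP[_ /c2]//]; rewrite cards2 n5.
- apply/subsetP=> A As; rewrite !inE (subsetP sT) // andbT.
  by rewrite (nside _ As) orbT.
- move=> i j k l; rewrite !in_setU1 !in_setD1.
  case/orP=> [/eqP/set2_inj e|/andP[nij ij]]; case/orP=> [/eqP/set2_inj e'|/andP[nkl kl]].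
  + by case: e => -[-> ->]; case: e' => -[-> ->]; cyclic.
  + case: e => -[-> ->]; first exact: ncbd.
    by move=> u1 u2; apply: (ncbd l k) => //; rewrite setUC.
  + move=> u1 u2; case: e' u1 u2 => -[-> ->] u1 u2.
      by apply: (ncbd j i); rewrite 1?[[set j; i]]setUC //; move: u1 u2; cyclic.
    by apply: (ncbd i j) => //; move: u1 u2; cyclic.
  + exact: nc.
have keep x y : [set x; y] \in T -> [set x; y] != [set a; c] -> [set x; y] \in flip T a b c d.
  by move=> u v; rewrite !inE u v orbT.
(* Only a triangle on a c has to be replaced; it is a b c or c d a, and its
   other two sides are next to a b d or b c d after the flip. *)
have fill_old i j k : [set i; j] \in T -> clockwise i k j ->
  [set i; j] \in flip T a b c d ->
  exists h : 'I_m, [/\ clockwise i h j, [set i; h] \in flip T a b c d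
                     & [set h; j] \in flip T a b c d].
  move=> ij ck ij'; have [h [ch ih hj]] := fill _ _ _ ij ck.
  have [e|n1'] := eqVneq [set i; h] [set a; c].
    have [[ei eh]|[ei eh]] := set2_inj e; subst i h.
      have -> : j = d.
        by apply: (@apex_uniq _ hT c a) => //; rewrite 1?setUC //; move: ch; cyclic.
      by exists b; split=> //; move: cb db; cyclic.
    have -> : j = b.
      by apply: (@apex_uniq _ hT a c) => //; rewrite 1?setUC //; move: ch; cyclic.
    by exists d; split=> //; rewrite 1?[[set _; _]]setUC //; move: cb db; cyclic.
  have [e|n2'] := eqVneq [set h; j] [set a; c].
    have [[eh ej]|[eh ej]] := set2_inj e; subst j h.
      have -> : i = d.
        by apply: (@apex_uniq _ hT c a) => //; rewrite 1?setUC //; move: ch; cyclic.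
      by exists b; split=> //; rewrite 1?[[set _; _]]setUC //; move: cb db; cyclic.
    have -> : i = b.
      by apply: (@apex_uniq _ hT a c) => //; rewrite 1?setUC //; move: ch; cyclic.
    by exists d; split=> //; rewrite 1?[[set _; _]]setUC //; move: cb db; cyclic.
  by exists h; split=> //; apply: keep.
move=> i j k ij' ck; move: (ij'); rewrite in_setU1 in_setD1.
case/orP=> [/eqP/set2_inj[] [ei ej]|/andP[_ ij]]; last exact: (fill_old i j k).
  by subst i j; exists c.
by subst i j; exists a.
Qed.

(** * Flips and quiver mutation *)

(** The clockwise adjacency that the quiver counts, as a boolean: [card_tri] shows
    that there is never more than one arrow. *)
Definition tri T A B : bool :=
  [exists i, exists j, exists l,
    [&& clockwise i j l, A == [set i; j], B == [set j; l] & [set l; i] \in T]].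

Lemma triP T A B :
  reflect (exists i j l, [/\ clockwise i j l, A = [set i; j], B = [set j; l]
                           & [set l; i] \in T]) (tri T A B).
Proof.
apply: (iffP existsP) => [[i /existsP[j /existsP[l /and4P[h /eqP-> /eqP-> h']]]]|].
  by exists i, j, l.
move=> [i [j [l [h -> -> h']]]]; exists i; apply/existsP; exists j.
by apply/existsP; exists l; rewrite h !eqxx.
Qed.

Lemma corner_uniq i j l i' j' l' :
  clockwise i j l -> clockwise i' j' l' ->
  [set i; j] = [set i'; j'] -> [set j; l] = [set j'; l'] ->
  [/\ i = i', j = j' & l = l'].
Proof.
move=> c1 c2 /set2_inj[][e1 e2] /set2_inj[][e3 e4]; subst=> //;
  by move: c1 c2; cyclic.
Qed.

(** Two arcs are adjacent in at most one triangle, so the number of arrows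
    between them is 0 or 1. *)
Lemma card_tri T A B :
  #|[set t : 'I_m * 'I_m * 'I_m |
      [&& clockwise t.1.1 t.1.2 t.2, A == [set t.1.1; t.1.2],
          B == [set t.1.2; t.2] & [set t.2; t.1.1] \in T]]| = tri T A B.
Proof.
case: triP => [[i [j [l [h -> -> h']]]]|no].
  rewrite (_ : [set _ | _] = [set (i, j, l)]) ?cards1 //.
  apply/setP=> -[[i' j'] l']; rewrite !inE /=; apply/idP/eqP.
    by case/and4P=> c /eqP e /eqP e' _; have [-> -> ->] := corner_uniq h c e e'.
  by case=> -> -> ->; rewrite h !eqxx.
apply/eqP; rewrite cards_eq0; apply/eqP/setP=> -[[i' j'] l']; rewrite !inE /=.
by apply/negP=> /and4P[c /eqP e /eqP e' t]; apply: no; exists i', j', l'.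
Qed.

Lemma tri_corner T i j l : i != j -> j != l -> l != i ->
  tri T [set i; j] [set j; l] = clockwise i j l && ([set l; i] \in T).
Proof.
move=> n1 n2 n3; apply/triP/andP=> [[i' [j' [l' [h e e' h']]]]|[h h']].
  case: (boolP (clockwise i j l)) => c.
    by have [-> _ ->] := corner_uniq c h e e'.
  have {}c : clockwise i l j by apply: clockwise_total.
  move/set2_inj: e => -[][e1 e2]; move/set2_inj: e' => -[][e3 e4]; subst;
    by [move: c h; cyclic | move: c h; rewrite /clockwise ; lia | rewrite ?eqxx in n1 n2 n3].
by exists i, j, l.
Qed.

Lemma tri_reversed T i j l : clockwise i j l -> tri T [set j; l] [set i; j] = false.
Proof.
move=> h; have [n1 n2 n3] := clockwise_neq h.
rewrite ![[set _; j]]setUC [[set j; l]]setUC tri_corner 1?eq_sym //.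
by apply/negP=> /andP[h2 _]; move: h h2; cyclic.
Qed.

Lemma tri_asym T A B : tri T A B -> tri T B A = false.
Proof. by case/triP=> i [j [l [h -> -> _]]]; exact: tri_reversed. Qed.

Section Exchange.

Variables (T : {set {set 'I_m}}) (a b c d : 'I_m).
Hypotheses (hT : triangulated T) (q : quad T a b c d).

Lemma tri_third_side A B i j l : A \in T -> B \in T -> clockwise i j l ->
  A = [set i; j] -> B = [set j; l] -> [set l; i] = [set a; c] ->
  A = [set a; b] /\ B = [set b; c] \/ A = [set c; d] /\ B = [set d; a].
Proof.
case: q => h1 h2 ac [ab bc cd da] AT BT h eA eB /set2_inj[][? ?]; subst.
  by right; have -> : j = d by apply: (@apex_uniq _ hT c a).
by left; have -> : j = b by apply: (@apex_uniq _ hT a c) => //; move: h1.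
Qed.

Lemma tri_out B : B \in T ->
  tri T [set a; c] B = (B == [set a; b]) || (B == [set c; d]).
Proof.
have [cb db] := quad_turn q; have [n1 n2 n3 [n4 n5 n6]] := quad_neq q.
case: q => h1 h2 ac [ab bc cd da] BT; apply/triP/orP.
  case=> i [j [l [h /set2_inj[][e1 e2] eB hl]]]; subst i j B.
    by right; apply/eqP; congr [set _; _]; apply: (@apex_uniq _ hT c a) => //; move: h; cyclic.
  by left; apply/eqP; congr [set _; _]; apply: (@apex_uniq _ hT a c) => //; move: h; cyclic.
case=> /eqP ->.
  by exists c, a, b; split; rewrite // 1?setUC //; move: h1; cyclic.
by exists a, c, d; split; rewrite // 1?setUC //; move: h2; cyclic.
Qed.

Lemma tri_in A : A \in T ->
  tri T A [set a; c] = (A == [set b; c]) || (A == [set d; a]).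
Proof.
have [cb db] := quad_turn q; have [n1 n2 n3 [n4 n5 n6]] := quad_neq q.
case: q => h1 h2 ac [ab bc cd da] AT; apply/triP/orP.
  case=> i [j [l [h eA /set2_inj[][e1 e2] hl]]]; subst j l A.
    right; apply/eqP; congr [set _; _]; apply: (@apex_uniq _ hT c a) => //; move: h; cyclic.
  left; apply/eqP; congr [set _; _]; apply: (@apex_uniq _ hT a c) => //; move: h; cyclic.
case=> /eqP ->.
  by exists b, c, a; split; rewrite // 1?setUC //; move: h1; cyclic.
by exists d, a, c; split; rewrite // 1?setUC //; move: h2; cyclic.
Qed.

End Exchange.

(** Quiver mutation at a diagonal is the flip. The paths of length two through
    a c are the four pairs of consecutive sides of the quadrilateral; two of
    them create the arrows of the new triangles, the two others cancel the
    arrows of the old ones. *)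
Lemma tri_flip T a b c d A B : triangulated T -> quad T a b c d ->
  A \in T -> B \in T -> A != [set a; c] -> B != [set a; c] ->
  tri (flip T a b c d) A B =
  ((tri T A B + tri T A [set a; c] * tri T [set a; c] B)
   - (tri T B A + tri T B [set a; c] * tri T [set a; c] A))%N :> nat.
Proof.
move=> hT q AT BT nA nB; have hT' := flip_triangulated hT q.
have q' := quad_flip q; set T' := flip T a b c d in hT' q' *.
have [n1 n2 n3 [n4 n5 n6]] := quad_neq q; have [cb db] := quad_turn q.
have [h1 h2 ac [ab bc cd da]] := q.
have bdT : [set b; d] \notin T.
  apply/negP=> bd; case: hT => _ _ nc _; exact: (nc _ _ _ _ ac bd).
have acT' : [set a; c] \notin T'.
  apply/negP=> bd; case: hT' => _ _ nc _; case: q' => _ _ h _.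
  by apply: (nc b d c a) => //; rewrite setUC.
pose X (P Q : {set 'I_m}) := (P == [set a; b]) && (Q == [set b; c])
   || (P == [set c; d]) && (Q == [set d; a]).
pose Y (P Q : {set 'I_m}) := (P == [set b; c]) && (Q == [set c; d])
   || (P == [set d; a]) && (Q == [set a; b]).
have inT' P : P \in T -> P != [set a; c] -> P \in T' by move=> u v; rewrite !inE u v orbT.
(* X lists the arrows lost in the flip, Y those that it creates. *)
have hX P Q : X P Q -> tri T P Q /\ tri T' P Q = false.
  have ne x y : x != y -> y != x by rewrite eq_sym.
  case/orP=> /andP[/eqP-> /eqP->]; rewrite !tri_corner //; try exact: ne.
    by rewrite h1 setUC ac (negPf acT').
  by rewrite h2 ac (negPf acT').
have hY P Q : Y P Q -> [/\ tri T' P Q, tri T P Q = false & tri T Q P = false].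
  have ne x y : x != y -> y != x by rewrite eq_sym.
  have [_ _ bd _] := q'.
  case/orP=> /andP[/eqP-> /eqP->]; rewrite tri_reversed // !tri_corner //; try exact: ne.
    by rewrite cb setUC bd (negPf bdT).
  by rewrite db bd (negPf bdT).
have E1 P Q : P \in T -> Q \in T -> P != [set a; c] -> Q != [set a; c] ->
    tri T' P Q -> Y P Q \/ tri T P Q.
  move=> PT QT nP nQ /triP[i [j [l [h eP eQ]]]]; rewrite in_setU1 in_setD1.
  case/orP=> [/eqP e|/andP[_ e]]; last by right; apply/triP; exists i, j, l.
  left; rewrite /Y.
  by have [] := tri_third_side hT' q' (inT' _ PT nP) (inT' _ QT nQ) h eP eQ e => -[-> ->];
    rewrite !eqxx ?orbT.
have E2 P Q : P \in T -> Q \in T -> tri T P Q -> X P Q \/ tri T' P Q.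
  move=> PT QT /triP[i [j [l [h eP eQ hl]]]].
  have [e|ne] := eqVneq [set l; i] [set a; c].
    by left; rewrite /X; have [] := tri_third_side hT q PT QT h eP eQ e => -[-> ->];
      rewrite !eqxx ?orbT.
  by right; apply/triP; exists i, j, l; split=> //; apply: inT'.
have hpath P Q : P \in T -> Q \in T ->
    (tri T P [set a; c] * tri T [set a; c] Q)%N = (Y P Q || X Q P).
  move=> PT QT; rewrite (tri_in hT q PT) (tri_out hT q QT) mulnb; congr (nat_of_bool _).
  by rewrite /X /Y; do 2!case: (P == _); do 2! case: (Q == _).
rewrite !hpath //.
case YAB: (Y A B).
  have [t -> ->] := hY _ _ YAB.
  have -> : Y B A = false by apply/negP=> /hY[]; rewrite (tri_asym t).
  have -> : X A B = false by apply/negP=> /hX[_]; rewrite t.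
  by rewrite t.
case YBA: (Y B A).
  have [t -> ->] := hY _ _ YBA.
  have -> : X B A = false by apply/negP=> /hX[_]; rewrite t.
  by rewrite (tri_asym t).
case p: (tri T A B).
  rewrite (tri_asym p).
  have -> : X B A = false by apply/negP=> /hX[]; rewrite (tri_asym p).
  case XAB: (X A B); first by have [_ ->] := hX _ _ XAB.
  by have [|->] := E2 _ _ AT BT p; rewrite ?XAB.
have -> : X A B = false by apply/negP=> /hX[]; rewrite p.
have -> : tri T' A B = false.
  by case t: (tri T' A B) => //; have [] := E1 _ _ AT BT nA nB t; rewrite ?YAB ?p.
by case XBA: (X B A) => //; have [-> _] := hX _ _ XBA.
Qed.

Lemma neighbor_before T i j : triangulated T -> j != i -> [set i; j] \notin T ->
  clockwise i (ordS i) j && ([set i; ordS i] \in T).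
Proof.
case=> _ sT _ _ nij h; have sd : [set i; ordS i] \in T.
  by apply: (subsetP sT); apply: imset_f.
by rewrite sd andbT clockwise_ordS //; apply: contraNneq h => ->.
Qed.

(** The arc to flip is the one that hides j from i: the side a c, opposite to i,
    of the triangle at i whose angle contains j. Here a is the last neighbour of
    i before j, and c is the apex of the triangle on the other side of a i. *)
Lemma widen_star T i j : triangulated T -> j != i -> [set i; j] \notin T ->
  exists a b c, quad T a b c i.
Proof.
move=> hT nij hij; have nb := neighbor_before hT nij hij.
have [a [ca /= ia amax]] := last_before (P := fun h => [set i; h] \in T) nb.
have [c2 _ nc fill] := hT.
have ai : [set a; i] \in T by rewrite setUC.
have caj : clockwise a j i by move: ca; cyclic.
have [c [cc ac ci]] := fill a i j ai caj.
have njc : j != c by apply: contraNneq hij => ->; rewrite setUC.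
have cj : clockwise a j c.
  apply/negP=> /negP nac; have /amax : clockwise a c j.
    by move: njc nac cc caj; rewrite -val_eqE /=; cyclic.
  by rewrite setUC ci.
have [b [cb ab bc]] := fill a c j ac cj.
exists a, b, c; split=> //; by move: cc; cyclic.
Qed.

End PolygonGeometry.

(** * Seeds labelled by the arcs of a triangulation *)

Lemma prod_two_factors (V : finType) (K : fieldType) (f : V -> K)
    (e : V -> nat) (u w : V) :
  u != w -> (forall v, e v = (v == u) || (v == w)) ->
  \prod_v f v ^+ e v = f u * f w.
Proof.
move=> nuw he; rewrite (bigD1 u) //= (bigD1 w) /=; last by rewrite eq_sym.
rewrite big1 ?mulr1 => [|v /andP[/negPf nu /negPf nw]]; last by rewrite he nu nw.
by rewrite !he !eqxx orbT !expr1.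
Qed.

Section LabelledSeeds.

Variables (n : nat) (V : finType) (K : fieldType).
Local Notation m := n.+3.
Implicit Types (s : seed V K) (lam : V -> {set 'I_m}) (k u v : V).
Implicit Types (a b c d : 'I_m).

Definition arcs lam : {set {set 'I_m}} := [set lam v | v : V].

Record labelled s lam : Prop := Labelled {
  labelled_inj : injective lam;
  labelled_triangulated : triangulated (arcs lam);
  labelled_frozen : forall v, frozen (seed_quiver s) v = (lam v \in sides m);
  labelled_arrows : forall u v, arrows (seed_quiver s) u v =
    if (lam u \in sides m) && (lam v \in sides m) then 0%N
    else tri (arcs lam) (lam u) (lam v)
}.

Definition relabel lam k (A : {set 'I_m}) : V -> {set 'I_m} :=
  fun v => if v == k then A else lam v.

Lemma mem_arcs lam v : lam v \in arcs lam.
Proof. exact: imset_f. Qed.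

Lemma arcs_relabel lam k a b c d : injective lam -> lam k = [set a; c] ->
  arcs (relabel lam k [set b; d]) = flip (arcs lam) a b c d.
Proof.
move=> inj hk; apply/setP=> A; rewrite in_setU1 in_setD1; apply/imsetP/idP.
  case=> v _ ->; rewrite /relabel; have [_|nv] := eqVneq v k; first by rewrite eqxx.
  by rewrite -hk (inj_eq inj) nv mem_arcs orbT.
case/orP=> [/eqP->|/andP[nA /imsetP[v _ eA]]]; first by exists k; rewrite // /relabel eqxx.
exists v => //; rewrite /relabel; case: eqP => // e.
by move: nA; rewrite eA e hk eqxx.
Qed.

Lemma quad_not_side (T : {set {set 'I_m}}) a b c d : quad T a b c d -> [set a; c] \notin sides m.
Proof.
move=> q; have [cb db] := quad_turn q; apply/negP=> As.
by apply: (sides_not_separated (k := c) (l := a) As _ cb db); rewrite setUC.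
Qed.

Lemma labelled_mutate s lam k a b c d : labelled s lam -> lam k = [set a; c] ->
  quad (arcs lam) a b c d ->
  labelled (mutate_seed s k) (relabel lam k [set b; d]).
Proof.
move=> [inj hT hf ha] hk q; have q' := quad_flip q.
have eT := arcs_relabel b d inj hk; have hT' := flip_triangulated hT q.
have acs := quad_not_side q; have bds := quad_not_side q'.
have nbd : [set b; d] \notin arcs lam.
  case: hT => _ _ nc _; apply/negP=> bd; have [cb db _ _] := q'; have [h1 h2 ac _] := q.
  exact: (nc _ _ _ _ ac bd).
have nk v : v != k -> lam v != [set a; c] by move=> nv; rewrite -hk (inj_eq inj).
have T' v : v != k -> lam v \in flip (arcs lam) a b c d.
  by move=> nv; rewrite in_setU1 in_setD1 nk // mem_arcs orbT.
split; first 1 last.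
- by rewrite eT.
- move=> v; rewrite /= hf /relabel; case: eqP => // ->.
  by rewrite hk (negPf acs) (negPf bds).
- move=> u v; rewrite eT /= /mutate_arrows /relabel.
  have [->|nu] := eqVneq u k; have [->|nv] := eqVneq v k => /=.
  + rewrite ha hk (negPf acs) (negPf bds) /=.
    by congr nat_of_bool; apply/idP/idP=> t; have := tri_asym t; rewrite t.
  + rewrite ha hk (negPf acs) (negPf bds) andbF /= (tri_in hT q) ?mem_arcs //.
    by rewrite (tri_out hT' q') ?T'.
  + rewrite ha hk (negPf acs) (negPf bds) andbF /= (tri_out hT q) ?mem_arcs //.
    by rewrite (tri_in hT' q') ?T' // orbC.
  + rewrite !hf; case: ifP => // nuv.
    have nvu : (lam v \in sides m) && (lam u \in sides m) = false by rewrite andbC.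
    rewrite !ha hk nuv nvu (negPf acs) /= !andbF.
    by rewrite -(tri_flip hT q) ?mem_arcs ?nk.
- move=> u v; rewrite /relabel.
  case: eqP => [->|_]; case: eqP => [->|_] //.
  + by move=> e; move: nbd; rewrite e mem_arcs.
  + by move=> e; move: nbd; rewrite -e mem_arcs.
  + exact: inj.
Qed.

(** The arrows out of a c go to two opposite sides of the quadrilateral, those
    into a c come from the two others. *)
Lemma mutated_var s lam k a b c d : labelled s lam -> lam k = [set a; c] ->
  quad (arcs lam) a b c d ->
  exists v1 v2 v3 v4,
    [/\ lam v1 = [set a; b], lam v2 = [set c; d], lam v3 = [set b; c],
        lam v4 = [set d; a] &
        seed_var (mutate_seed s k) k =
        (seed_var s v1 * seed_var s v2 + seed_var s v3 * seed_var s v4)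
          / seed_var s k].
Proof.
move=> [inj hT hf ha] hk q; have [n1 n2 n3 [n4 n5 n6]] := quad_neq q.
have acs := quad_not_side q.
case: (q) => _ _ _ [/imsetP[v1 _ e1] /imsetP[v3 _ e3] /imsetP[v2 _ e2] /imsetP[v4 _ e4]].
exists v1, v2, v3, v4; split=> //=; rewrite eqxx; congr ((_ + _) / _).
  apply: prod_two_factors => [|v].
    rewrite -(inj_eq inj) -e1 -e2; apply/eqP=> /set2_inj[][e _];
      by move: n2 n3; rewrite e eqxx.
  rewrite ha hk (negPf acs) /= (tri_out hT q) ?mem_arcs //.
  by rewrite e1 e2 !(inj_eq inj).
apply: prod_two_factors => [|v].
  rewrite -(inj_eq inj) -e3 -e4; apply/eqP=> /set2_inj[][e e'];
    by move: n1 n5; rewrite e eqxx.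
rewrite ha hk (negPf acs) andbF (tri_in hT q) ?mem_arcs //.
by rewrite e3 e4 !(inj_eq inj).
Qed.

(** Mutation together with the bookkeeping of which arc each vertex of the
    quiver currently stands for. *)
Inductive flip_reach s0 lam0 : seed V K -> (V -> {set 'I_m}) -> Prop :=
  | flip_reach_refl : flip_reach s0 lam0 s0 lam0
  | flip_reach_step s lam k a b c d :
      flip_reach s0 lam0 s lam -> lam k = [set a; c] ->
      quad (arcs lam) a b c d ->
      flip_reach s0 lam0 (mutate_seed s k) (relabel lam k [set b; d]).

Section Reach.

Variables (s0 : seed V K) (lam0 : V -> {set 'I_m}).
Hypothesis (h0 : labelled s0 lam0).

Lemma flip_reach_labelled s lam : flip_reach s0 lam0 s lam -> labelled s lam.
Proof.
by elim=> // {}s {}lam k a b c d _ h hk q; exact: labelled_mutate q.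
Qed.

Lemma flip_reach_mutation s lam :
  flip_reach s0 lam0 s lam -> mutation_equivalent s0 s.
Proof.
elim=> [|{}s {}lam k a b c d r h hk q]; first exact: mutation_equivalent_refl.
apply: mutation_equivalent_step => //.
by rewrite (labelled_frozen (flip_reach_labelled r)) hk; apply: quad_not_side q.
Qed.

Lemma mutation_flip_reach s :
  mutation_equivalent s0 s -> exists lam, flip_reach s0 lam0 s lam.
Proof.
elim=> [|{}s k _ [lam r] hk]; first by exists lam0; apply: flip_reach_refl.
have hl := flip_reach_labelled r; rewrite (labelled_frozen hl) in hk.
have [a [b [c [d [ek q]]]]] := quad_exists (labelled_triangulated hl) (mem_arcs lam k) hk.
by exists (relabel lam k [set b; d]); apply: flip_reach_step q.
Qed.

(** Induction over seeds seen one arc at a time: what remains to check is the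
    exchange relation of a single quadrilateral. *)
Lemma flip_reach_ind_var (W : {set 'I_m} -> K -> Prop) :
  (forall v, W (lam0 v) (seed_var s0 v)) ->
  (forall a b c d x x1 x2 x3 x4, clockwise a b c -> clockwise c d a ->
     W [set a; c] x -> W [set a; b] x1 -> W [set c; d] x2 ->
     W [set b; c] x3 -> W [set d; a] x4 ->
     W [set b; d] ((x1 * x2 + x3 * x4) / x)) ->
  forall s lam, flip_reach s0 lam0 s lam ->
  forall v, W (lam v) (seed_var s v).
Proof.
move=> W0 Wstep s lam; elim=> // {}s {}lam k a b c d r IH hk q v.
rewrite /relabel; have [->|nv] := eqVneq v k; last by rewrite /= (negPf nv).
have [v1 [v2 [v3 [v4 [e1 e2 e3 e4 ->]]]]] := mutated_var (flip_reach_labelled r) hk q.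
case: q => h1 h2 _ _; apply: (Wstep a b c d) => //.
- by rewrite -hk.
- by rewrite -e1.
- by rewrite -e2.
- by rewrite -e3.
- by rewrite -e4.
Qed.

(** A flip chosen as in widen_star adds a neighbour to i and removes none. *)
Lemma reach_star i : exists s lam, flip_reach s0 lam0 s lam /\
  forall j, j != i -> [set i; j] \in arcs lam.
Proof.
pose miss lam := #|[set j : 'I_m | (j != i) && ([set i; j] \notin arcs lam)]|.
suff: forall N s lam, (miss lam < N)%N -> flip_reach s0 lam0 s lam ->
    exists s' lam', flip_reach s0 lam0 s' lam' /\
    forall j, j != i -> [set i; j] \in arcs lam'.
  by move/(_ (miss lam0).+1 s0 lam0 (ltnSn _)); apply; apply: flip_reach_refl.
elim=> // N IH s lam hN r; have hl := flip_reach_labelled r.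
have hT := labelled_triangulated hl.
have [/pred0P all|/existsP[j]] := boolP (pred0b
    [pred j : 'I_m | (j != i) && ([set i; j] \notin arcs lam)]).
  exists s, lam; split=> // j nj; have := all j; rewrite /= nj => /negbT.
  by rewrite negbK.
move=> /andP[nj hj]; have [a [b [c q]]] := widen_star hT nj hj.
have [_ _ /imsetP[k _ hk] _] := q.
have r' := flip_reach_step r (esym hk) q.
apply: (IH _ _ _ r'); rewrite -ltnS; apply: leq_trans hN.
have eT := arcs_relabel b i (labelled_inj hl) (esym hk).
have [_ _ _ [_ nbi _]] := quad_neq q.
rewrite ltnS; apply: proper_card; apply/properP; split.
  apply/subsetP=> x; rewrite !inE => /andP[-> /=]; apply: contra => hx.
  rewrite eT in_setU1 in_setD1 hx andbT; apply/orP; right; apply/eqP=> /set2_inj.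
  by have [_ n2 n3 [_ _ n6]] := quad_neq q; case=> -[e _]; move: n3 n6; rewrite e eqxx.
exists b; rewrite !inE nbi /=.
  apply/negP=> bi; case: hT => _ _ nc _; have [cb db _ _] := quad_flip q.
  have [h1 h2 ac _] := q; apply: (nc _ _ _ _ ac _ h1 h2); by rewrite setUC.
by rewrite negbK eT setUC setU11.
Qed.

End Reach.

End LabelledSeeds.

(** * Specialization of fractions *)

Section Localization.

Variables (R : comNzRingType) (K L : fieldType).
Variables (f : {rmorphism R -> K}) (g : {rmorphism R -> L}).

(** The graph of g extended to the fractions of R in K whose denominator g
    does not kill. As a relation it needs no construction of the localization,
    and two of them compose. *)
Definition specializes (x : K) (y : L) : Prop :=
  exists P D, [/\ g D != 0, x * f D = f P & y * g D = g P].

Lemma specializes_base P : specializes (f P) (g P).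
Proof. by exists P, 1; rewrite !rmorph1 !mulr1 oner_eq0. Qed.

Lemma specializesD x y x' y' :
  specializes x y -> specializes x' y' -> specializes (x + x') (y + y').
Proof.
move=> [P [D [hD h1 h2]]] [P' [D' [hD' h1' h2']]].
exists (P * D' + P' * D), (D * D'); rewrite !rmorphM !rmorphD !rmorphM.
by rewrite mulf_neq0 // -h1 -h2 -h1' -h2'; split=> //; ring.
Qed.

Lemma specializesM x y x' y' :
  specializes x y -> specializes x' y' -> specializes (x * x') (y * y').
Proof.
move=> [P [D [hD h1 h2]]] [P' [D' [hD' h1' h2']]].
exists (P * P'), (D * D'); rewrite !rmorphM.
by rewrite mulf_neq0 // -h1 -h2 -h1' -h2'; split=> //; ring.
Qed.

Lemma specializesN x y : specializes x y -> specializes (- x) (- y).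
Proof.
move=> [P [D [hD h1 h2]]]; exists (- P), D.
by rewrite !rmorphN -h1 -h2 !mulNr.
Qed.

Hypothesis f_inj : injective f.

Lemma embedding_neq0 D : g D != 0 -> f D != 0.
Proof.
apply: contraNneq => e; apply/eqP; suff -> : D = 0 by rewrite rmorph0.
by apply: f_inj; rewrite rmorph0.
Qed.

Lemma specializes_neq0 x y : specializes x y -> y != 0 -> x != 0.
Proof.
move=> [P [D [hD h1 h2]]]; apply: contraNneq => e; subst x.
have P0 : P = 0 by apply: f_inj; rewrite -h1 mul0r rmorph0.
by move/eqP: h2; rewrite P0 rmorph0 mulf_eq0 (negPf hD) orbF.
Qed.

Lemma specializesV x y : specializes x y -> y != 0 -> specializes x^-1 y^-1.
Proof.
move=> h y0; have x0 := specializes_neq0 h y0.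
case: h => P [D [hD h1 h2]]; have fD := embedding_neq0 hD.
exists D, P; rewrite -h1 -h2 mulf_neq0 //.
by split=> //; rewrite mulrA mulVf // mul1r.
Qed.

Lemma specializes_inj x y y' : specializes x y -> specializes x y' -> y = y'.
Proof.
move=> [P [D [hD h1 h2]]] [P' [D' [hD' h1' h2']]].
have e : P * D' = P' * D by apply: f_inj; rewrite !rmorphM -h1 -h1'; ring.
have /(congr1 g) := e; rewrite !rmorphM -h2 -h2' => e2.
apply: (mulIf (mulf_neq0 hD hD')); rewrite mulrA e2; ring.
Qed.

End Localization.

(** * Configurations of plane vectors *)

Definition det2 (R : comNzRingType) (u v : R * R) : R := u.1 * v.2 - u.2 * v.1.

Lemma det2C (R : comNzRingType) (u v : R * R) : det2 u v = - det2 v u.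
Proof. by rewrite /det2; ring. Qed.

Lemma det2_plucker (R : comNzRingType) (u v w z : R * R) :
  det2 u w * det2 v z = det2 u v * det2 w z + det2 u z * det2 v w.
Proof. by rewrite /det2; ring. Qed.

Section ArcMinors.

Variables (n : nat) (R : comNzRingType).
Local Notation m := n.+3.
Implicit Types (w : 'I_m -> R * R) (i j a b c d : 'I_m).

(** A single term contributes when A has two elements: the minor of its vertices
    in increasing order, so that no sign enters the exchange relation. *)
Definition arc_minor w (A : {set 'I_m}) : R :=
  \sum_(p : 'I_m * 'I_m | (p.1 < p.2)%N && (A == [set p.1; p.2]))
    det2 (w p.1) (w p.2).

Lemma arc_minorE w i j : (i < j)%N -> arc_minor w [set i; j] = det2 (w i) (w j).
Proof.
move=> ij; rewrite /arc_minor (big_pred1 (i, j)) //= => -[k l] /=.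
rewrite xpair_eqE; apply/andP/andP => [[kl /eqP/set2_inj[][e e']]|[/eqP-> /eqP->]].
- by rewrite e e' !eqxx.
- by move: kl ij; rewrite e e'; lia.
- by rewrite ij eqxx.
Qed.

Lemma arc_minor_lt w i j : (j < i)%N -> arc_minor w [set i; j] = - det2 (w i) (w j).
Proof. by move=> ji; rewrite setUC arc_minorE // det2C. Qed.

(** For a < b < c < d this is the Pluecker relation, a d being read in increasing
    order; rotating a b c d only permutes the factors and the two products. *)
Lemma arc_minor_ptolemy w a b c d : clockwise a b c -> clockwise c d a ->
  arc_minor w [set a; c] * arc_minor w [set b; d] =
  arc_minor w [set a; b] * arc_minor w [set c; d]
  + arc_minor w [set b; c] * arc_minor w [set d; a].
Proof.
have H (i j k l : 'I_m) : (i < j < k)%N -> (k < l)%N ->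
    arc_minor w [set i; k] * arc_minor w [set j; l] =
    arc_minor w [set i; j] * arc_minor w [set k; l]
    + arc_minor w [set j; k] * arc_minor w [set l; i].
  move=> h1 h2; rewrite [[set l; i]]setUC !arc_minorE; try lia.
  by rewrite det2_plucker; ring.
move=> h1 h2.
have [u|[u|[u|u]]] : [&& a < b, b < c & c < d]%N \/ [&& b < c, c < d & d < a]%N
   \/ [&& c < d, d < a & a < b]%N \/ [&& d < a, a < b & b < c]%N.
- by move: h1 h2; cyclic.
- by apply: H; lia.
- have := @H b c d a; rewrite [[set c; a]]setUC => E.
  by rewrite mulrC E; try lia; rewrite addrC mulrC [X in _ + X]mulrC; ring.
- have := @H c d a b; rewrite [[set c; a]]setUC [[set d; b]]setUC => E.
  by rewrite E; try lia; ring.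
- have := @H d a b c; rewrite [[set d; b]]setUC => E.
  by rewrite mulrC E; try lia; ring.
Qed.

End ArcMinors.

(** Adding t * (1, t^i) to the i-th vector works: for i < j the determinant of
    vectors i and j has coefficient 1 at t^(j + 2), which no other of its terms
    reaches. *)
Lemma generic_deformation (m : nat) (F : fieldType) (v : 'I_m -> F * F) :
  exists w : 'I_m -> {poly F} * {poly F},
    (forall i j, i != j -> det2 (w i) (w j) != 0) /\
    (forall i j, (det2 (w i) (w j)).[0] = det2 (v i) (v j)).
Proof.
exists (fun i => ((v i).1%:P + 'X, (v i).2%:P + 'X^(i.+1))); split; last first.
  by move=> i j; rewrite /det2 /= !hornerE /= !expr0n /= !addr0.
have lt (i j : 'I_m) : (i < j)%N -> det2 ((v i).1%:P + 'X, (v i).2%:P + 'X^(i.+1))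
   ((v j).1%:P + 'X, (v j).2%:P + 'X^(j.+1)) != 0.
  move=> ij; apply/eqP=> /(congr1 (fun p : {poly F} => p`_(j.+2))) /eqP.
  rewrite /det2 /= !mulrDl !mulrDr -!polyCM !coefB !coefD coef0.
  rewrite !coefC !coefCM !coefMC !coefXM !coefMX !coefXn ?coefX /=.
  have -> : (j.+2 == j.+1) = false by lia.
  have -> : (j.+1 == i.+1) = false by lia.
  have -> : (j.+2 == i.+1) = false by lia.
  rewrite eqxx !mulr0 ?mul0r ?add0r ?addr0 ?eqSS ?(gtn_eqF ij).
  by rewrite ?mulr0 ?addr0 ?subr0 ?add0r ?oner_eq0.
move=> i j; rewrite -val_eqE /= => nij.
have [ij|ji] := ltnP i j; first exact: lt.
by rewrite det2C oppr_eq0 lt //; lia.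
Qed.

(** * Cluster variables as minors *)

Section Coordinates.

Variables (n : nat) (T : {set {set 'I_n.+3}}).
Local Notation m := n.+3.
Local Notation V := (Defs.arc T).
Local Notation K := (ambient_field V).
Local Notation s0 := (initial_seed (triangulation_quiver T)).
Local Notation lam0 := (val : V -> {set 'I_m}).

(** Integer coefficients, because the target of a specialization may have
    positive characteristic. *)
Definition int_polynomial_embedding : {rmorphism {mpoly int[#|V|]} -> K} :=
  @tofrac {mpoly rat[#|V|]} \o map_mpoly (intr : int -> rat).

Definition arc_evaluation (L : fieldType) (z : {set 'I_m} -> L) :
    {rmorphism {mpoly int[#|V|]} -> L} :=
  mmap (intr : int -> L) (fun i => z (val (enum_val i))).

Lemma int_polynomial_embedding_inj : injective int_polynomial_embedding.
Proof.
move=> p q /eqP; rewrite /= tofrac_eq => /eqP e.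
apply/mpolyP=> u; apply: (@intr_inj rat).
by rewrite -!mcoeff_map_mpoly e.
Qed.

Lemma embedding_initial_var v :
  int_polynomial_embedding 'X_(enum_rank v) = initial_var v.
Proof. by rewrite /= map_mpolyX. Qed.

Lemma arc_evaluation_initial_var (L : fieldType) (z : {set 'I_m} -> L) v :
  arc_evaluation z 'X_(enum_rank v) = z (val v).
Proof. by rewrite /= mmapX mmap1U enum_rankK. Qed.

Hypothesis hT : is_triangulation T.

Lemma initial_labelled : labelled s0 lam0.
Proof.
have eT : arcs lam0 = T.
  apply/setP=> A; apply/imsetP/idP => [[v _ ->]|AT]; first exact: valP.
  by exists (Sub A AT).
split=> //; first exact: val_inj.
  by rewrite eT; apply: maximal_triangulated.
move=> u v; rewrite eT /= /triangulation_arrows; case: ifP => // _.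
by rewrite -card_tri.
Qed.


Local Notation reach := (flip_reach s0 lam0).

Section Specialization.

Variables (L : fieldType) (w : 'I_m -> L * L).
Hypothesis w_gen : forall i j, i != j -> det2 (w i) (w j) != 0.

Definition specializes_at : K -> L -> Prop :=
  specializes int_polynomial_embedding (arc_evaluation (arc_minor w)).

Lemma arc_minor_neq0 i j : i != j -> arc_minor w [set i; j] != 0.
Proof.
move=> nij; have [ij|ji|e] := ltngtP i j.
- by rewrite arc_minorE // w_gen.
- by rewrite arc_minor_lt // oppr_eq0 w_gen.
- by move: nij; rewrite (val_inj e) eqxx.
Qed.

Lemma specializes_flip a b c d x x1 x2 x3 x4 :
  clockwise a b c -> clockwise c d a ->
  specializes_at x (arc_minor w [set a; c]) ->
  specializes_at x1 (arc_minor w [set a; b]) ->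
  specializes_at x2 (arc_minor w [set c; d]) ->
  specializes_at x3 (arc_minor w [set b; c]) ->
  specializes_at x4 (arc_minor w [set d; a]) ->
  specializes_at ((x1 * x2 + x3 * x4) / x) (arc_minor w [set b; d]).
Proof.
move=> h1 h2 hx hx1 hx2 hx3 hx4; have [_ _ nca] := clockwise_neq h1.
have ac0 : arc_minor w [set a; c] != 0 by apply: arc_minor_neq0; rewrite eq_sym.
suff -> : arc_minor w [set b; d] =
    (arc_minor w [set a; b] * arc_minor w [set c; d]
     + arc_minor w [set b; c] * arc_minor w [set d; a]) / arc_minor w [set a; c].
  apply: specializesM; last first.
    by apply: specializesV => //; exact: int_polynomial_embedding_inj.
  by apply: specializesD; apply: specializesM.
by rewrite -arc_minor_ptolemy // mulrAC mulfV // mul1r.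
Qed.

Lemma seed_var_specializes s lam : reach s lam ->
  forall v, specializes_at (seed_var s v) (arc_minor w (lam v)).
Proof.
move=> r; apply: (flip_reach_ind_var initial_labelled
   (W := fun A x => specializes_at x (arc_minor w A)) _ _ r) => [v|].
  rewrite /= -embedding_initial_var -(arc_evaluation_initial_var (arc_minor w)).
  exact: specializes_base.
exact: specializes_flip.
Qed.

End Specialization.

Lemma reach_card2 s lam v : reach s lam -> exists i j, i != j /\ lam v = [set i; j].
Proof.
move=> /(flip_reach_labelled initial_labelled) hl.
have [c2 _ _ _] := labelled_triangulated hl.
have /eqP/cards2P[i [j [nij ->]]] := c2 _ (mem_arcs lam v).
by exists i, j.
Qed.

(** A pairwise independent configuration over some field takes the variable to
    a nonzero value. *)
Lemma seed_var_neq0 s lam v : reach s lam -> seed_var s v != 0.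
Proof.
move=> r; have [i [j [nij e]]] := reach_card2 v r.
have [w [w_gen _]] := @generic_deformation m rat (fun _ => (0, 0)).
pose w' i : {fraction {poly rat}} * {fraction {poly rat}} :=
  (tofrac (w i).1, tofrac (w i).2).
have w'_gen k l : k != l -> det2 (w' k) (w' l) != 0.
  by move=> /w_gen; rewrite /det2 /= -!tofracM -tofracB tofrac_eq0.
apply: (specializes_neq0 _ (seed_var_specializes w'_gen r v)).
  exact: int_polynomial_embedding_inj.
by rewrite e arc_minor_neq0.
Qed.

(** The exchange relation is symmetric in the old and the new variable, and the
    new one is nonzero; so it determines the old variable as well. *)
Lemma realization_pullback s lam (w : 'I_m -> K * K) : reach s lam ->
  (forall v, seed_var s v = arc_minor w (lam v)) ->
  forall v, seed_var s0 v = arc_minor w (lam0 v).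
Proof.
elim=> // {}s {}lam k a b c d r IH hk q hw; apply: IH => v.
have r' := flip_reach_step r hk q.
have inj := labelled_inj (flip_reach_labelled initial_labelled r).
have off u : u != k -> seed_var s u = arc_minor w (lam u).
  by move=> nu; have := hw u; rewrite /relabel /= (negPf nu).
have [->|] := eqVneq v k; last exact: off.
have [v1 [v2 [v3 [v4 [e1 e2 e3 e4 ek]]]]] :=
  mutated_var (flip_reach_labelled initial_labelled r) hk q.
have [n1 n2 n3 [n4 n5 n6]] := quad_neq q.
have nk u x y : lam u = [set x; y] -> [|| x == b, y == b, x == d | y == d] -> u != k.
  move=> eu h; apply/eqP=> e; move: eu h; rewrite e hk => /set2_inj[][<- <-];
  by rewrite (negPf n1) (negPf n3) (eq_sym c b) (negPf n4) (negPf n6).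
have x0 : seed_var s k != 0 by exact: seed_var_neq0 r.
have y0 : seed_var (mutate_seed s k) k != 0 by exact: seed_var_neq0 r'.
apply: (mulIf y0); rewrite {1}ek mulrC divfK // hw /relabel eqxx hk.
have nk1 : v1 != k by apply: (nk _ _ _ e1); rewrite eqxx ?orbT.
have nk2 : v2 != k by apply: (nk _ _ _ e2); rewrite eqxx ?orbT.
have nk3 : v3 != k by apply: (nk _ _ _ e3); rewrite eqxx ?orbT.
have nk4 : v4 != k by apply: (nk _ _ _ e4); rewrite eqxx ?orbT.
have [h1 h2 _ _] := q; rewrite arc_minor_ptolemy // -e1 -e2 -e3 -e4.
by rewrite (off _ nk1) (off _ nk2) (off _ nk3) (off _ nk4).
Qed.

(** A star at 0 consists of the arcs 0 j and the sides j (j + 1), because any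
    other arc i j would cross 0 (i + 1). *)
Lemma star_realization s lam : reach s lam ->
  (forall j, j != ord0 -> [set ord0; j] \in arcs lam) ->
  exists w : 'I_m -> K * K, forall v, seed_var s v = arc_minor w (lam v).
Proof.
move=> r star; have hl := flip_reach_labelled initial_labelled r.
have [_ _ nc _] := labelled_triangulated hl.
pose z A := if [pick v | lam v == A] is Some v then seed_var s v else 0.
have zE v : z (lam v) = seed_var s v.
  rewrite /z; case: pickP => [u /eqP/(labelled_inj hl)->//|/(_ v)].
  by rewrite eqxx.
pose z0 k := z [set ord0; inord k]; pose z1 k := z [set inord k; inord k.+1].
(* The second coordinates are the variables of the arcs from the vertex 0;
   the sides j (j + 1) then determine the first ones one after the other. *)
pose fix U k := if k is k'.+1 then (U k' * z0 k - z1 k') / z0 k' else 0.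
exists (fun i : 'I_m => if i == ord0 then (1, 0) else (U i, z0 i)) => v.
have main (i j : 'I_m) : (i < j)%N -> lam v = [set i; j] ->
    seed_var s v = arc_minor (fun h : 'I_m => if h == ord0 then (1, 0) else (U h, z0 h)) (lam v).
  move=> ij e; rewrite -zE e arc_minorE //.
  have -> : (j == ord0) = false by rewrite -val_eqE /=; lia.
  have [->|ni] := eqVneq i ord0.
    by rewrite /det2 /= mul0r subr0 mul1r /z0 inord_val.
  have ni0 : (0 < i)%N by rewrite lt0n; move: ni; rewrite -val_eqE.
  have eij : val j = i.+1.
    have i1 : (i.+1 < m)%N by have := ltn_ord j; lia.
    have st : [set Ordinal i1; ord0] \in arcs lam by rewrite setUC star.
    have [//|nj] := eqVneq (val j) i.+1; exfalso.
    have ijT : [set i; j] \in arcs lam by rewrite -e mem_arcs.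
    by apply: (nc _ _ _ _ ijT st); move: ni0 ij nj; rewrite /clockwise /=; lia.
  have z0i : z0 i != 0.
    have /imsetP[u _ eu] := star i ni.
    by rewrite /z0 inord_val eu zE; exact: seed_var_neq0 r.
  rewrite /det2 /= eij /= -eij.
  rewrite eij /=.
  have -> : z1 i = z [set i; j] by rewrite /z1 inord_val -eij inord_val.
  by rewrite [z0 i * _]mulrC divfK // subKr.
have [i [j [nij e]]] := reach_card2 v r.
have [ij|ji|e'] := ltngtP i j.
- exact: (main i j).
- by apply: (main j i); rewrite // setUC.
- by move: nij; rewrite (val_inj e') eqxx.
Qed.

(** A configuration realizing a star realizes the initial seed, and from there
    the exchange relation propagates it to all seeds. *)
Lemma coordinates_exist : exists w : 'I_m -> K * K,
  forall s lam, reach s lam -> forall v, seed_var s v = arc_minor w (lam v).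
Proof.
have [s [lam [r star]]] := reach_star initial_labelled (ord0 : 'I_m).
have [w hw] := star_realization r star.
exists w => s' lam' r' v; have hw0 := realization_pullback r hw.
elim: r' v => // {}s' {}lam' k a b c d r' IH hk q v.
rewrite /relabel; have [->|nv] := eqVneq v k; last by rewrite /= (negPf nv).
have [v1 [v2 [v3 [v4 [e1 e2 e3 e4 ->]]]]] :=
  mutated_var (flip_reach_labelled initial_labelled r') hk q.
have := seed_var_neq0 k r'; rewrite !IH e1 e2 e3 e4 hk => x0.
have [h1 h2 _ _] := q.
by rewrite -arc_minor_ptolemy // mulrAC mulfV // mul1r.
Qed.

End Coordinates.

(** * Morphisms from the cluster algebra *)

Section ClusterAlgebraVal.

Variables (V : finType) (Q : ice_quiver V).
Implicit Types a b : cluster_algebra Q.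

Lemma cluster_val1 : val (1 : cluster_algebra Q) = 1.
Proof. exact: rmorph1. Qed.

Lemma cluster_valD a b : val (a + b) = val a + val b.
Proof. exact: rmorphD. Qed.

Lemma cluster_valN a : val (- a) = - val a.
Proof. exact: rmorphN. Qed.

Lemma cluster_valM a b : val (a * b) = val a * val b.
Proof. exact: rmorphM. Qed.

End ClusterAlgebraVal.

(** The elements at which G is defined form a subring containing the generators,
    so G is defined everywhere and choice turns it into a function. *)
Lemma rmorphism_of_graph (V : finType) (Q : ice_quiver V) (F : fieldType)
    (G : ambient_field V -> F -> Prop) :
  (forall x y y', G x y -> G x y' -> y = y') -> G 1 1 ->
  (forall x y x' y', G x y -> G x' y' -> G (x - x') (y - y')) ->
  (forall x y x' y', G x y -> G x' y' -> G (x * x') (y * y')) ->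
  (forall x, cluster_generator Q x -> exists y, G x y) ->
  exists phi : {rmorphism cluster_algebra Q -> F},
    forall a, G (val a) (phi a).
Proof.
move=> Gfun G1 GB GM Ggen.
have total (a : cluster_algebra Q) : exists y, G (val a) y.
  have /asboolP := valP a; move/(_ (fun x => `[< exists y, G x y >])) => H.
  apply/asboolP; apply: H => [|x /Ggen h]; last exact/asboolP.
  split=> [|x x' /asboolP[y h] /asboolP[y' h']|x x' /asboolP[y h] /asboolP[y' h']];
    apply/asboolP.
  - by exists 1.
  - by exists (y - y'); apply: GB.
  - by exists (y * y'); apply: GM.
pose phi a := projT1 (cid (total a)).
have phiG a : G (val a) (phi a) by rewrite /phi; case: cid.
have phiB : zmod_morphism phi.
  move=> a b; apply: (Gfun _ _ _ (phiG _)); rewrite rmorphB.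
  exact: GB (phiG a) (phiG b).
have phiM : monoid_morphism phi.
  split=> [|a b]; first by apply: (Gfun _ _ _ (phiG _)); rewrite rmorph1.
  by apply: (Gfun _ _ _ (phiG _)); rewrite rmorphM; exact: GM (phiG a) (phiG b).
pose hB := GRing.isZmodMorphism.Build _ _ phi phiB.
pose hM := GRing.isMonoidMorphism.Build _ _ phi phiM.
pose phi' : {rmorphism cluster_algebra Q -> F} := HB.pack phi hB hM.
by exists phi'.
Qed.

Lemma cluster_algebra_ext (V : finType) (Q : ice_quiver V) (F : fieldType)
    (phi psi : {rmorphism cluster_algebra Q -> F}) :
  (forall a, cluster_generator Q (val a) -> phi a = psi a) -> phi =1 psi.
Proof.
move=> h a.
pose P : {pred ambient_field V} := fun x => `[< exists b, val b = x /\ phi b = psi b >].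
suff /asboolP[b [/val_inj<- //]] : val a \in P.
have /asboolP := valP a; apply.
  split=> [|x y /asboolP[b [<- e]] /asboolP[b' [<- e']]
           |x y /asboolP[b [<- e]] /asboolP[b' [<- e']]]; apply/asboolP.
  - by exists 1; rewrite !rmorph1.
  - by exists (b - b'); rewrite !rmorphB e e'.
  - by exists (b * b'); rewrite !rmorphM e e'.
move=> x hx; apply/asboolP.
have xA : x \in generated_subring (cluster_generator Q).
  by apply/asboolP=> P' _; apply.
by exists (Sub x xA); rewrite SubK; split=> //; apply: h; rewrite SubK.
Qed.

Section Points.

Variables (n : nat) (T : {set {set 'I_n.+3}}) (hT : is_triangulation T).
Local Notation m := n.+3.
Local Notation V := (Defs.arc T).
Local Notation K := (ambient_field V).
Local Notation Q := (triangulation_quiver T).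
Local Notation s0 := (initial_seed Q).
Local Notation lam0 := (val : V -> {set 'I_m}).
Local Notation reach := (flip_reach s0 lam0).

Variable w : 'I_m -> K * K.
Hypothesis hw : forall s lam, reach s lam ->
  forall v, seed_var s v = arc_minor w (lam v).

Lemma generator_mem x : cluster_generator Q x ->
  x \in generated_subring (cluster_generator Q).
Proof. by move=> hx; apply/asboolP=> P _; apply. Qed.

(** The arc i j belongs to the star of i. *)
Lemma seed_minor i j : i != j -> exists s lam v,
  [/\ reach s lam, lam v = [set i; j] &
      det2 (w i) (w j) = if (i < j)%N then seed_var s v else - seed_var s v].
Proof.
move=> nij; have [s [lam [r star]]] := reach_star (initial_labelled hT) i.
have /star/imsetP[v _ ev] : j != i by rewrite eq_sym.
exists s, lam, v; split=> //; rewrite (hw r) -ev.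
case: ltnP => ij; first by rewrite arc_minorE.
rewrite arc_minor_lt ?opprK //.
by move: nij; rewrite -val_eqE /=; lia.
Qed.

Lemma minor_mem i j : det2 (w i) (w j) \in generated_subring (cluster_generator Q).
Proof.
have [->|nij] := eqVneq i j; first by rewrite /det2 mulrC subrr rpred0.
have [s [lam [v [r ev ->]]]] := seed_minor nij.
have sA : seed_var s v \in generated_subring (cluster_generator Q).
  apply: generator_mem; left; exists s, v; split=> //.
  exact: (flip_reach_mutation (initial_labelled hT) r).
by case: ifP => _; rewrite ?rpredN.
Qed.

(** Defined for all i and j, with the sign of the determinant: the Pluecker
    relations then hold without any condition on the order of the indices. *)
Definition plucker i j : cluster_algebra Q := Sub (det2 (w i) (w j)) (minor_mem i j).

Lemma val_plucker i j : val (plucker i j) = det2 (w i) (w j).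
Proof. exact: SubK. Qed.

Lemma side_inverse i : exists a, a * plucker i (ordS i) = 1.
Proof.
have side : [set i; ordS i] \in sides m by apply: imset_f.
have [_ /subsetP sT _ _] := labelled_triangulated (initial_labelled hT).
have /imsetP[v _ /esym ev] := sT _ side.
have iA : (initial_var v)^-1 \in generated_subring (cluster_generator Q).
  by apply: generator_mem; right; exists v; split; rewrite //= ev.
have v0 : initial_var v != 0 := seed_var_neq0 hT v (flip_reach_refl _ _).
have iv : initial_var v = arc_minor w (val v) := hw (flip_reach_refl s0 lam0) v.
have [a ea] : exists a : cluster_algebra Q, val a = (initial_var v)^-1.
  by exists (ClusterAlgebra iA).
have [ij|ij] := ltnP i (ordS i).
  exists a; apply: val_inj; rewrite cluster_valM cluster_val1 ea val_plucker.
  by rewrite -arc_minorE // -ev -iv mulVf.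
exists (- a); apply: val_inj.
rewrite cluster_valM cluster_valN cluster_val1 ea val_plucker.
rewrite -[det2 _ _]opprK -arc_minor_lt; last first.
  by have := ordS_neq i; rewrite -val_eqE /=; move: ij; rewrite /=; lia.
by rewrite -ev -iv mulrNN mulVf.
Qed.

Lemma reach_sorted s lam v : reach s lam ->
  exists i j : 'I_m, (i < j)%N /\ lam v = [set i; j].
Proof.
move=> r; have [i [j [nij e]]] := reach_card2 hT v r.
have [ij|ji|e'] := ltngtP i j; first by exists i, j.
  by exists j, i; rewrite setUC.
by move: nij; rewrite (val_inj e') eqxx.
Qed.

Section Morphisms.

Variable F : fieldType.
Implicit Types phi psi : {rmorphism cluster_algebra Q -> F}.

Lemma side_neq0 phi i : phi (plucker i (ordS i)) != 0.
Proof.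
have [a /(congr1 phi)] := side_inverse i; rewrite rmorphM rmorph1 => e.
by apply: contra_eq_neq e => ->; rewrite mulr0 eq_sym oner_eq0.
Qed.

(** The Pluecker coordinates together with the inverses of the sides are the
    generators, and a morphism is determined on inverses. *)
Lemma plucker_ext phi psi :
  (forall i j, phi (plucker i j) = psi (plucker i j)) -> phi =1 psi.
Proof.
move=> h; apply: cluster_algebra_ext => a.
have var s lam v b : reach s lam -> val b = seed_var s v -> phi b = psi b.
  move=> r e; have [i [j [ij ev]]] := reach_sorted v r.
  suff -> : b = plucker i j by [].
  by apply: val_inj; rewrite val_plucker e (hw r) ev arc_minorE.
case=> [[s [v [ms e]]]|[v [_ e]]].
  have [lam r] := mutation_flip_reach (initial_labelled hT) ms.
  exact: var r e.
have v0 : initial_var v != 0 := seed_var_neq0 hT v (flip_reach_refl _ _).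
have vA : initial_var v \in generated_subring (cluster_generator Q).
  apply: generator_mem; left; exists s0, v; split=> //.
  exact: mutation_equivalent_refl.
pose b := ClusterAlgebra vA.
have eb : phi b = psi b by apply: (var s0 lam0 v) (flip_reach_refl _ _) _; rewrite SubK.
have ab : a * b = 1 by apply: val_inj; rewrite cluster_valM cluster_val1 e mulVf.
have := congr1 phi ab; have := congr1 psi ab; rewrite !rmorphM !rmorph1 eb => e1 e2.
have pb0 : psi b != 0 by apply: contra_eq_neq e1 => ->; rewrite mulr0 eq_sym oner_eq0.
by apply: (mulIf pb0); rewrite e1 e2.
Qed.

Lemma plucker_relation phi i j k l :
  phi (plucker i k) * phi (plucker j l) =
  phi (plucker i j) * phi (plucker k l) + phi (plucker i l) * phi (plucker j k).
Proof.
rewrite -!rmorphM -rmorphD; congr (phi _); apply: val_inj.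
by rewrite cluster_valD !cluster_valM !val_plucker det2_plucker.
Qed.

Lemma plucker_anti phi i j : phi (plucker i j) = - phi (plucker j i).
Proof.
by rewrite -rmorphN; congr (phi _); apply: val_inj; rewrite cluster_valN !val_plucker det2C.
Qed.

(** The morphism is the composite of two specializations: from the ambient field
    to F(t), along a pairwise independent deformation of v, and from F(t) to F at
    t = 0. *)
Lemma point_of_configuration (v : 'I_m -> F * F) :
  (forall i, det2 (v i) (v (ordS i)) != 0) ->
  exists phi, forall i j, phi (plucker i j) = det2 (v i) (v j).
Proof.
move=> hv; have [w1 [w1_gen w1_v]] := generic_deformation v.
pose L := {fraction {poly F}}.
pose w2 i : L * L := (tofrac (w1 i).1, tofrac (w1 i).2).
have w2E i j : det2 (w2 i) (w2 j) = tofrac (det2 (w1 i) (w1 j)).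
  by rewrite /det2 tofracB !tofracM.
have w2_gen i j : i != j -> det2 (w2 i) (w2 j) != 0.
  by move=> nij; rewrite w2E tofrac_eq0 w1_gen.
have emb_inj := @int_polynomial_embedding_inj n T.
pose frac : {rmorphism {poly F} -> L} := @tofrac {poly F}.
pose at0 : {rmorphism {poly F} -> F} := horner_eval (0 : F).
have frac_inj : injective frac by move=> p q /eqP; rewrite tofrac_eq => /eqP.
pose G (x : K) (y : F) := exists l, specializes_at w2 x l /\ specializes frac at0 l y.
have G_base x p : specializes_at w2 x (tofrac p) -> G x p.[0].
  by move=> h; exists (tofrac p); split=> //; exact: (specializes_base frac at0 p).
have GN x y : G x y -> G (- x) (- y).
  by move=> [l [h1 h2]]; exists (- l); split; apply: specializesN.
have GD x y x' y' : G x y -> G x' y' -> G (x + x') (y + y').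
  by move=> [l [h1 h2]] [l' [h1' h2']]; exists (l + l'); split; apply: specializesD.
have GM x y x' y' : G x y -> G x' y' -> G (x * x') (y * y').
  by move=> [l [h1 h2]] [l' [h1' h2']]; exists (l * l'); split; apply: specializesM.
have Gfun x y y' : G x y -> G x y' -> y = y'.
  move=> [l [h1 h2]] [l' [h1' h2']]; have e := specializes_inj emb_inj h1 h1'.
  by subst l'; exact: (specializes_inj frac_inj h2 h2').
have GV x y : G x y -> y != 0 -> G x^-1 y^-1.
  move=> [l [h1 h2]] y0; have l0 := specializes_neq0 frac_inj h2 y0.
  by exists l^-1; split; apply: specializesV.
have Gvar s lam u : reach s lam -> forall i j : 'I_m, (i < j)%N -> lam u = [set i; j] ->
    G (seed_var s u) (det2 (v i) (v j)).
  move=> r i j ij e; rewrite -w1_v; apply: G_base; rewrite -w2E -arc_minorE //.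
  by rewrite -e; exact: seed_var_specializes.
have [phi hphi] : exists phi : {rmorphism cluster_algebra Q -> F}, forall a, G (val a) (phi a).
  apply: rmorphism_of_graph => //.
  - have := G_base 1 1; rewrite hornerC; apply; rewrite tofrac1.
    have := specializes_base (@int_polynomial_embedding n T) (arc_evaluation T (arc_minor w2)) 1.
    by rewrite !rmorph1.
  - by move=> x y x' y' h h'; apply: GD => //; apply: GN.
  - move=> x [[s [u [ms ->]]]|[u [su ->]]].
      have [lam r] := mutation_flip_reach (initial_labelled hT) ms.
      have [i [j [ij e]]] := reach_sorted u r.
      by exists (det2 (v i) (v j)); apply: Gvar r _ _ ij e.
    have [i [j [ij e]]] := reach_sorted u (flip_reach_refl s0 lam0).
    exists (det2 (v i) (v j))^-1; apply: GV.
      exact: (Gvar s0 lam0 u (flip_reach_refl _ _) i j ij e).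
    move: su; rewrite /= e => /imsetP[k _ /set2_inj[][-> ->]]; first exact: hv.
    by rewrite det2C oppr_eq0 hv.
exists phi => i j; apply: (Gfun (det2 (w i) (w j))); first by rewrite -val_plucker.
have [->|nij] := eqVneq i j.
  rewrite /det2 mulrC subrr mulrC subrr.
  by have := GD _ _ _ _ (hphi 1) (GN _ _ (hphi 1)); rewrite !subrr.
have [s [lam [u [r eu ->]]]] := seed_minor nij.
case: ltnP => ij; first exact: Gvar r _ _ ij eu.
rewrite det2C; apply: GN; apply: (Gvar _ _ _ r); last by rewrite setUC.
by move: nij; rewrite -val_eqE /=; move: ij; lia.
Qed.

End Morphisms.

End Points.

(** * Counting configurations *)

Section CountingPaths.

Variable F : finFieldType.
Implicit Types (u v : F * F) (k : nat).

Definition indep : rel (F * F) := fun u v => det2 u v != 0.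

(** The condition on the last vector is its independence from (1, 0). *)
Definition open_paths k u : {set k.-tuple (F * F)} :=
  [set t : k.-tuple (F * F) | path indep u t && ((last u t).2 != 0)].

Lemma open_pathsS k u :
  #|open_paths k.+1 u| = (\sum_(v | indep u v) #|open_paths k v|)%N.
Proof.
rewrite -sum1_card.
pose h (p : (F * F) * k.-tuple (F * F)) : k.+1.-tuple (F * F) := [tuple of p.1 :: p.2].
rewrite (reindex h) /=; last first.
  exists (fun t => (thead t, [tuple of behead t])) => [[v t] _|t _].
    by congr pair; apply: val_inj.
  by rewrite /h /= -tuple_eta.
under [RHS]eq_bigr do rewrite -sum1_card.
rewrite pair_big_dep /=; apply: eq_bigl => -[v t].
by rewrite !inE /= andbA.
Qed.

Local Notation q := (#|F|%:R : rat).

Lemma sum_constant_neq (R : nzRingType) (c : F) (x : R) :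
  \sum_(y : F | y != c) x = (#|F|%:R - 1) * x.
Proof.
have -> : \sum_(y : F | y != c) x = \sum_(y : F) x - x.
  by rewrite [X in _ = X - _](bigD1 c) //= [x + _]addrC addrK.
by rewrite sumr_const mulrBl mul1r mulr_natl.
Qed.

(** For each second coordinate y of v, independence of u excludes one first
    coordinate if u.2 is nonzero; if u.2 = 0 it only says that y is nonzero. *)
Lemma sum_indep u (A B : rat) : u != 0 ->
  \sum_(v | indep u v) (if v.2 != 0 then A else B) =
  if u.2 != 0 then (q - 1) * (B + (q - 1) * A) else q * (q - 1) * A.
Proof.
move=> u0.
have -> : \sum_(v | indep u v) (if v.2 != 0 then A else B)
  = \sum_(y : F) \sum_(x : F | indep u (x, y)) (if y != 0 then A else B).
  rewrite (exchange_big_dep xpredT) //= pair_big_dep /=.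
  by apply: eq_big => [[x y]|[x y]].
have [u2|u2] := boolP (u.2 != 0); last first.
  rewrite negbK in u2; have u1 : u.1 != 0.
    by apply: contraNneq u0 => e; rewrite [u]surjective_pairing e (eqP u2).
  have E y : \sum_(x : F | indep u (x, y)) (if y != 0 then A else B) =
      if y != 0 then q * A else 0.
    rewrite /indep /det2 /= (eqP u2).
    under eq_bigl do rewrite mul0r subr0 mulf_eq0 (negPf u1) /=.
    by case: ifP => _; rewrite ?big_pred0_eq // sumr_const mulr_natl.
  under eq_bigr do rewrite E.
  by rewrite -big_mkcond /= sum_constant_neq; ring.
have E y : \sum_(x : F | indep u (x, y)) (if y != 0 then A else B) =
    (q - 1) * (if y != 0 then A else B).
  rewrite -(sum_constant_neq (u.1 * y / u.2)); apply: eq_bigl => x.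
  rewrite /indep /det2 /= subr_eq0; congr (~~ _).
  by rewrite -[LHS](inj_eq (mulIf (invr_neq0 u2))) [u.2 * x]mulrC mulfK // eq_sym.
under eq_bigr do rewrite E.
rewrite -mulr_sumr (bigD1 0) //= eqxx /=; congr (_ * (_ + _)).
rewrite -(sum_constant_neq 0); by apply: eq_bigr => y ->.
Qed.

(** With al_k = (q^k - (-1)^k) / (q + 1), the two counts are
    (q - 1)^k al_(k+1) and q (q - 1)^k al_k, and sum_indep becomes the recursion
    al_(k+2) = (q - 1) al_(k+1) + q al_k, with roots q and -1. *)
Lemma card_open_paths k u : u != 0 -> #|open_paths k u|%:R =
  if u.2 != 0 then (q - 1) ^+ k * ((q ^+ k.+1 - (-1) ^+ k.+1) / (q + 1))
  else q * (q - 1) ^+ k * ((q ^+ k - (-1) ^+ k) / (q + 1)).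
Proof.
have q1 : q + 1 != 0 :> rat by rewrite -(natrD _ _ 1) Num.Theory.pnatr_eq0 addn1.
elim: k u => [|k IH] u u0.
  rewrite !expr0 subrr mul0r mulr0 !expr1 opprK divff // mulr1.
  rewrite /open_paths; case: ifP => h.
    rewrite (_ : [set t | _] = [set [tuple]]) ?cards1 //.
    by apply/setP=> t; rewrite tuple0 !inE /= h eqxx.
  rewrite (_ : [set t | _] = set0) ?cards0 //.
  by apply/setP=> t; rewrite tuple0 !inE /= h.
rewrite open_pathsS natr_sum.
rewrite (eq_bigr (fun v => if v.2 != 0 then (q - 1) ^+ k * ((q ^+ k.+1 - (-1) ^+ k.+1) / (q + 1))
  else q * (q - 1) ^+ k * ((q ^+ k - (-1) ^+ k) / (q + 1)))) => [|v uv]; last first.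
  by apply: IH; apply: contraNneq uv => ->; rewrite /det2 !mulr0 subrr.
rewrite sum_indep //; case: ifP => _; rewrite !exprS; field => //.
Qed.

End CountingPaths.

Lemma rmorphism_eq (A B : pzSemiRingType) (phi psi : {rmorphism A -> B}) :
  phi =1 psi -> phi = psi.
Proof.
case: phi psi => [f [[f1] [f2]]] [g [[g1] [g2]]] /= /funext e.
subst g; have -> : f1 = g1 by exact: Prop_irrelevance.
by have -> : f2 = g2 by exact: Prop_irrelevance.
Qed.

(** * Points and normalized configurations *)

Section NormalForm.

Variables (n : nat) (F : finFieldType).
Local Notation m := n.+3.
Implicit Types (p : F * n.+1.-tuple (F * F)).

(** A pair (b, t) encodes the vectors (1, 0), (0, b) followed by those of t: each
    SL_2 orbit of configurations with v_0 and v_1 independent has exactly one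
    member of this shape. *)
Definition normal_forms : {set F * n.+1.-tuple (F * F)} :=
  [set p | (p.1 != 0) && (p.2 \in open_paths n.+1 (0, p.1))].

Definition configuration p (k : nat) : F * F :=
  nth 0 [:: (1, 0), (0, p.1) & p.2] k.

Lemma normal_formsP p :
  reflect (forall i : 'I_m, det2 (configuration p i) (configuration p (ordS i)) != 0)
    (p \in normal_forms).
Proof.
have last_nth : last (0, p.1) p.2 = nth 0 p.2 n.
  rewrite -(nth_last (0, p.1)) size_tuple; apply: set_nth_default.
  by rewrite size_tuple.
apply: (iffP idP) => [|hp].
  rewrite !inE => /andP[b0 /andP[/(pathP 0) hp hl]] i.
  rewrite /configuration ordS_val; case: ifP => [/eqP->|ni].
    by rewrite /= -last_nth /det2 mulr0 mulr1 sub0r oppr_eq0.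
  case: i ni => -[|[|i]] hi ni /=.
  - by rewrite /det2 mul1r mul0r subr0.
  - by have := hp 0%N; rewrite size_tuple; apply.
  - have := hp i.+1; rewrite size_tuple /indep /=; apply; move: hi ni => /=; lia.
rewrite !inE; apply/and3P; split.
- by have := hp ord0; rewrite /configuration ordS_val /det2 /= mul1r mul0r subr0.
- apply/(pathP 0) => i; rewrite size_tuple => hi.
  have hi' : (i.+1 < m)%N by lia.
  have := hp (Ordinal hi'); rewrite /configuration ordS_val /=.
  by have -> : (i.+1 == n.+2) = false by lia.
- have := hp ord_max; rewrite /configuration ordS_val /= eqxx last_nth.
  by rewrite /det2 mulr0 mulr1 sub0r oppr_eq0.
Qed.

Lemma card_normal_forms : #|normal_forms|%:R =
  (#|F|%:R - 1) ^+ n.+2 * ((#|F|%:R ^+ n.+2 + (-1) ^+ n.+3) / (#|F|%:R + 1)) :> rat.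
Proof.
have -> : #|normal_forms| = (\sum_(b : F | b != 0%R) #|open_paths n.+1 ((0%R : F), b)|)%N.
  rewrite -sum1_card; under [RHS]eq_bigr do rewrite -sum1_card.
  by rewrite pair_big_dep /=; apply: eq_bigl => p; rewrite inE.
rewrite natr_sum.
rewrite (eq_bigr (fun _ => (#|F|%:R - 1) ^+ n.+1 *
    ((#|F|%:R ^+ n.+2 - (-1) ^+ n.+2) / (#|F|%:R + 1) : rat))) => [|b b0].
  by rewrite sum_constant_neq !exprS; ring.
rewrite card_open_paths /= ?b0 //.
by apply: contraNneq b0 => -[->].
Qed.

End NormalForm.

Theorem proposition3p8 (m : nat) (hm : (4 <= m)%N) (T : {set {set 'I_m}})
    (hT : is_triangulation T) (F : finFieldType) :
  exists N : nat,
    (exists f : cluster_variety_point T F -> 'I_N, bijective f)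
    /\ N%:Q = (#|F|%:Q - 1) ^+ (m - 1)
              * ((#|F|%:Q ^+ (m - 1) + (-1) ^+ m) / (#|F|%:Q + 1)).
Proof.
case: m hm T hT => [|[|[|n]]] // _ T hT.
exists #|normal_forms n F|; split; last first.
  by rewrite -!pmulrn card_normal_forms subn1.
have [w hw] := coordinates_exist hT.
pose x := plucker hT hw.
pose v1 : 'I_n.+3 := lift ord0 ord0.
have v1E : v1 = ordS ord0 by apply: val_inj; rewrite /= modn_small.
(* The Pluecker relation for the indices 0, 1, i, j says that these vectors have
   the right determinants. *)
pose vec (phi : cluster_variety_point T F) k : F * F :=
  (- phi (x v1 k) / phi (x ord0 v1), phi (x ord0 k)).
have b0 (phi : cluster_variety_point T F) : phi (x ord0 v1) != 0.
  by rewrite v1E; apply: side_neq0.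
have xx (phi : cluster_variety_point T F) i : phi (x i i) = 0.
  have -> : x i i = 0; last exact: rmorph0.
  by apply: val_inj; rewrite [LHS]val_plucker /det2 mulrC subrr.
have vec_det phi i j : det2 (vec phi i) (vec phi j) = phi (x i j).
  apply: (mulfI (b0 phi)).
  have := plucker_relation hT hw phi ord0 v1 i j; rewrite -/x => E.
  transitivity (phi (x ord0 i) * phi (x v1 j) - phi (x ord0 j) * phi (x v1 i)).
    by rewrite /det2 /vec /=; field; exact: b0.
  by rewrite E addrK.
pose code (phi : cluster_variety_point T F) : F * n.+1.-tuple (F * F) :=
  (phi (x ord0 v1), [tuple vec phi (inord i.+2) | i < n.+1]).
have code_conf phi (i : 'I_n.+3) : configuration (code phi) i = vec phi i.
  case: i => -[|[|i]] hi; rewrite /configuration /=.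
  - rewrite (_ : Ordinal hi = ord0); last exact: val_inj.
    rewrite /vec xx; have := plucker_anti hT hw phi v1 ord0; rewrite -/x => ->.
    by rewrite opprK divff.
  - rewrite (_ : Ordinal hi = v1); last exact: val_inj.
    by rewrite /vec xx oppr0 mul0r.
  - have hi' : (i < n.+1)%N by [].
    rewrite -[i]/(val (Ordinal hi')) nth_mktuple /=; congr vec.
    by apply: val_inj; rewrite /= inordK.
have code_in phi : code phi \in normal_forms n F.
  by apply/normal_formsP=> i; rewrite !code_conf vec_det; apply: side_neq0.
have code_inj phi psi : code phi = code psi -> phi = psi.
  move=> e; apply: rmorphism_eq; apply: (plucker_ext (hT := hT) (hw := hw)) => i j.
  by rewrite -/x -!vec_det -!code_conf e.
have code_surj p : p \in normal_forms n F -> exists phi, code phi = p.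
  move/normal_formsP=> hp.
  have [phi hphi] := point_of_configuration hT hw hp; rewrite -/x in hphi.
  exists phi; have eb : phi (x ord0 v1) = p.1.
    by rewrite hphi /configuration /det2 /= mul1r mul0r subr0.
  have pb : p.1 != 0 by rewrite -eb.
  rewrite /code eb; case: p hp hphi eb pb => b t /= hp hphi eb pb; congr pair.
  apply: eq_from_tnth => i; rewrite tnth_mktuple /vec eb !hphi.
  have hi : (i.+2 < n.+3)%N by rewrite !ltnS -ltnS.
  rewrite inordK // /configuration /= (tnth_nth 0) /det2 /=.
  rewrite mul0r sub0r opprK mul1r mul0r subr0 mulrAC divff // mul1r.
  by rewrite -surjective_pairing.
(* enum_rank_in needs a member of the set as a witness of its inhabitation; the
   code itself is at hand. *)
exists (fun phi => enum_rank_in (code_in phi) (code phi)).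
have rankK phi : enum_val (enum_rank_in (code_in phi) (code phi)) = code phi.
  by rewrite enum_rankK_in.
exists (fun k => projT1 (cid (code_surj _ (enum_valP k)))) => [phi|k].
  by case: cid => psi /=; rewrite rankK; apply: code_inj.
by case: cid => psi /= e; apply: enum_val_inj; rewrite rankK.
Qed.
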